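(* Let $\Gamma$ be a compact connected metric graph, let $\Phi=(M,R,\check M,\check R)$ be a root datum with Weyl group $W$, and let $G=\check M_{\mathbb R}\rtimes W$. Denote by $W_\Gamma$ the trivial $W$-torsor on $\Gamma$. Then there are natural bijections $$\widetilde{\mathcal M}_{G,W_\Gamma}=\mathrm{Pic}(\Gamma)\otimes_{\mathbb Z}\check M,\qquad \mathcal M_{G,W_\Gamma}=\big(\mathrm{Pic}(\Gamma)\otimes_{\mathbb Z}\check M\big)/W.$$
   Context: $\mathcal H_\Gamma$ is the sheaf of harmonic functions on $\Gamma$: continuous piecewise linear real functions with integer slopes whose outgoing slopes at every point sum to zero. $\mathrm{Pic}(\Gamma)=H^1(\Gamma,\mathcal H_\Gamma)$ is the group of isomorphism classes of tropical line bundles. A (tropical) $G$-bundle is a torsor under $G_\Gamma=(\check M\otimes_{\mathbb Z}\mathcal H_\Gamma)\rtimes W$. A $G$-bundle $E$ has an associated $W$-torsor $E_W$ via $G_\Gamma\to W$. For a $W$-torsor $\tau$ on $\Gamma$, $\widetilde{\mathcal M}_{G,\tau}$ is the set of isomorphism classes of pairs $(E,\phi)$ with $E$ a $G$-bundle and $\phi:E_W\to\tau$ an isomorphism, and $\mathcal M_{G,\tau}$ is the set of isomorphism classes of $G$-bundles $E$ with $E_W\cong\tau$. $W$ acts on $\mathrm{Pic}(\Gamma)\otimes\check M$ through its action on $\check M$. *)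

(* Defs.v *)
From HB Require Import structures.
From mathcomp Require Import all_boot all_order all_algebra.
From mathcomp Require Import generic_quotient ring_quotient freeg.
From mathcomp Require Import boolp classical_sets functions cardinality reals.
From mathcomp Require Import topology.

Set Implicit Arguments.
Unset Strict Implicit.
Unset Printing Implicit Defensive.

Import Order.TTheory GRing.Theory Num.Theory.
Local Open Scope classical_set_scope.
Local Open Scope ring_scope.
Local Open Scope quotient_scope.

Section Tensor.
Variables A B : zmodType.

(* The subgroup of the free abelian group on [A * B] generated by the
   bilinearity relations. *)
Inductive bilinear_rel : {freeg (A * B)} -> Prop :=
| BilinearRel0 : bilinear_rel 0
| BilinearRelB x y : bilinear_rel x -> bilinear_rel y -> bilinear_rel (x - y)
| BilinearRelDl a a' b :
    bilinear_rel (<< (a + a', b) >> - << (a, b) >> - << (a', b) >>)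
| BilinearRelDr a b b' :
    bilinear_rel (<< (a, b + b') >> - << (a, b) >> - << (a, b') >>).

Definition bilinear_pred : {pred {freeg (A * B)}} := fun x => `[< bilinear_rel x >].

Lemma bilinear_pred_closed : zmod_closed bilinear_pred.
Proof.
split=> [|x y]; first exact/asboolP/BilinearRel0.
by move=> /asboolP hx /asboolP hy; apply/asboolP/BilinearRelB.
Qed.

HB.instance Definition _ :=
  GRing.isZmodClosed.Build {freeg (A * B)} bilinear_pred bilinear_pred_closed.

Definition bilinear_sub : zmodClosed {freeg (A * B)} := bilinear_pred.

Definition tensor : Type := Quotient.quot bilinear_sub.
HB.instance Definition _ := GRing.Zmodule.on tensor.

Definition tens (a : A) (b : B) : tensor :=
  \pi_(Quotient.quot bilinear_sub) << (a, b) >>.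

Lemma tensor_piB (x y : {freeg (A * B)}) :
  \pi_(Quotient.quot bilinear_sub) (x - y) =
  \pi_(Quotient.quot bilinear_sub) x - \pi_(Quotient.quot bilinear_pred) y.
Proof. by rewrite !piE. Qed.

Lemma tensor_pi0 (x : {freeg (A * B)}) : bilinear_rel x ->
  \pi_(Quotient.quot bilinear_sub) x = 0.
Proof.
move=> h; rewrite !piE; apply/eqP.
by rewrite -Quotient.idealrBE subr0; apply/asboolP.
Qed.

Lemma tensDl a a' b : tens (a + a') b = tens a b + tens a' b.
Proof.
apply/eqP; rewrite -subr_eq0 opprD addrA -!tensor_piB; apply/eqP/tensor_pi0.
exact: BilinearRelDl.
Qed.

Lemma tensDr a b b' : tens a (b + b') = tens a b + tens a b'.
Proof.
apply/eqP; rewrite -subr_eq0 opprD addrA -!tensor_piB; apply/eqP/tensor_pi0.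
exact: BilinearRelDr.
Qed.

Section Lift.
Variables (C : zmodType) (f : A -> B -> C).

Definition tensor_lift (t : tensor) : C :=
  fglift (fun p : A * B => f p.1 p.2 : zmodule C)
    (repr (t : Quotient.quot bilinear_sub)).

Hypothesis fDl : forall a a' b, f (a + a') b = f a b + f a' b.
Hypothesis fDr : forall a b b', f a (b + b') = f a b + f a b'.

Let g : {freeg (A * B)} -> zmodule C :=
  fglift (fun p : A * B => f p.1 p.2 : zmodule C).

Let gB x y : g (x - y) = g x - g y.
Proof. exact: lift_is_additive. Qed.

Let gU p : g << p >> = f p.1 p.2.
Proof. by rewrite /g liftU scale1r. Qed.

Let g_rel x : bilinear_rel x -> g x = 0.
Proof.
elim=> [|u v _ hu _ hv|a a' b|a b b'].
- by have := gB 0 0; rewrite subr0 subrr.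
- by rewrite gB hu hv subr0.
- by rewrite !gB !gU /= fDl addrAC addrK subrr.
- by rewrite !gB !gU /= fDr addrAC addrK subrr.
Qed.

Let g_pi x : tensor_lift (\pi_(Quotient.quot bilinear_sub) x) = g x.
Proof.
rewrite /tensor_lift -/g; case: piP => y /eqmodP.
rewrite /= /Quotient.equiv => /asboolP/g_rel; rewrite gB.
by move/eqP; rewrite subr_eq0 => /eqP.
Qed.

Lemma tensor_liftB : {morph tensor_lift : x y / x - y}.
Proof.
move=> x y; rewrite -[x]reprK -[y]reprK.
by rewrite -tensor_piB !g_pi gB.
Qed.

Lemma tensor_liftE a b : tensor_lift (tens a b) = f a b.
Proof. by rewrite g_pi gU. Qed.

End Lift.
End Tensor.

Lemma tensor_ind (A B : zmodType) (P : tensor A B -> Prop) :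
  P 0 -> (forall x y, P x -> P y -> P (x - y)) ->
  (forall a b, P (tens a b)) -> forall t, P t.
Proof.
move=> P0 PB Pt t; have PN x : P x -> P (- x) by move=> h; rewrite -sub0r; exact: PB.
have PD x y : P x -> P y -> P (x + y).
  by move=> hx hy; rewrite -[y]opprK; apply: PB => //; apply: PN.
pose q := \pi_(Quotient.quot (@bilinear_sub A B)) : {freeg (A * B)} -> tensor A B.
have qB x y : q (x - y) = q x - q y by exact: tensor_piB.
have q0 : q 0 = 0 by rewrite -(subrr 0) qB subrr.
have qN x : q (- x) = - q x by rewrite -sub0r qB q0 sub0r.
have qD x y : q (x + y) = q x + q y by rewrite -[y]opprK qB qN !opprK.
have Pq (k : int) (x : A * B) : P (q << k *g x >>).
  rewrite -[k]intz -freegU_mulz; case: k => n.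
    rewrite -pmulrn; elim: n => [|n IH]; first by rewrite mulr0n q0.
    by rewrite mulrS qD; apply: PD => //; case: x {IH} => a b; apply: Pt.
  rewrite NegzE -nmulrn qN; apply: PN.
  elim: n => [|n IH]; first by case: x => a b; rewrite mulr1n; apply: Pt.
  by rewrite mulrS qD; apply: PD => //; case: x {IH} => a b; apply: Pt.
rewrite -[t]reprK -/(q _) -[repr _]freeg_sumE.
elim/big_rec: _ => [|z y _ hy]; first by rewrite q0.
by rewrite qD; apply: PD.
Qed.

Lemma tensor_ext (A B C : zmodType) (f g : {additive tensor A B -> C}) :
  (forall a b, f (tens a b) = g (tens a b)) -> f =1 g.
Proof.
move=> fg; elim/tensor_ind => [|x y hx hy|//]; first by rewrite !raddf0.
by rewrite !raddfB hx hy.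
Qed.

Section TensorMap.
Variables (A A' B B' : zmodType) (f : {additive A -> A'}) (g : {additive B -> B'}).

Definition tensor_map : tensor A B -> tensor A' B' :=
  tensor_lift (fun a b => tens (f a) (g b)).

Lemma tensor_map_is_zmod_morphism : zmod_morphism tensor_map.
Proof.
by apply: tensor_liftB => [a a' b|a b b']; rewrite raddfD (tensDl, tensDr).
Qed.

HB.instance Definition _ :=
  GRing.isZmodMorphism.Build (tensor A B) (tensor A' B') tensor_map
    tensor_map_is_zmod_morphism.

Lemma tensor_mapE a b : tensor_map (tens a b) = tens (f a) (g b).
Proof.
by apply: tensor_liftE => [{}a a' {}b|{}a {}b b']; rewrite raddfD (tensDl, tensDr).
Qed.

Lemma tensor_map0 : tensor_map 0 = 0. Proof. exact: raddf0. Qed.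
Lemma tensor_mapB : {morph tensor_map : x y / x - y}. Proof. exact: raddfB. Qed.

End TensorMap.

Lemma tensor_map_id (A B : zmodType) (t : tensor A B) : tensor_map idfun idfun t = t.
Proof.
by apply: (tensor_ext (f := tensor_map _ _) (g := idfun)) => a b; exact: tensor_mapE.
Qed.

Lemma tensor_map_comp (A A' A'' B B' B'' : zmodType)
    (f : {additive A -> A'}) (f' : {additive A' -> A''}) (h : {additive A -> A''})
    (g : {additive B -> B'}) (g' : {additive B' -> B''}) (k : {additive B -> B''}) :
  (forall a, f' (f a) = h a) -> (forall b, g' (g b) = k b) ->
  forall t, tensor_map f' g' (tensor_map f g t) = tensor_map h k t.
Proof.
move=> hE kE; elim/tensor_ind => [|x y hx hy|a b]; first by rewrite !tensor_map0.
  by rewrite !tensor_mapB hx hy.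
by rewrite !tensor_mapE hE kE.
Qed.

(* [vectType int] is the type of free abelian groups of finite rank. *)
Record root_datum := RootDatum {
  rd_M : vectType int;
  rd_Mc : vectType int;
  rd_pair : rd_M -> rd_Mc -> int;
  rd_pairDl : forall x x' y, rd_pair (x + x') y = rd_pair x y + rd_pair x' y;
  rd_pairDr : forall x y y', rd_pair x (y + y') = rd_pair x y + rd_pair x y';
  rd_perfectl : forall f : {additive rd_M -> int},
    exists! y, forall x, f x = rd_pair x y;
  rd_perfectr : forall f : {additive rd_Mc -> int},
    exists! x, forall y, f y = rd_pair x y;
  rd_root : set rd_M;
  rd_coroot : set rd_Mc;
  rd_check : rd_M -> rd_Mc;
  rd_finite : finite_set rd_root;
  rd_check_bij : set_bij rd_root rd_coroot rd_check;
  rd_pair2 : forall a, rd_root a -> rd_pair a (rd_check a) = 2;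
  rd_refl_root : forall a b, rd_root a -> rd_root b ->
    rd_root (b - rd_pair b (rd_check a) *: a);
  rd_refl_coroot : forall a b, rd_root a -> rd_coroot b ->
    rd_coroot (b - rd_pair a b *: rd_check a)
}.

Section Weyl.
Variable Phi : root_datum.
Notation Mc := (rd_Mc Phi).

Definition coreflection (a : rd_M Phi) (y : Mc) : Mc :=
  y - rd_pair a y *: rd_check a.

(* The group generated by the coreflections; no closure under inverses is
   required because coreflections are involutions. *)
Inductive in_weyl : (Mc -> Mc) -> Prop :=
| InWeyl1 : in_weyl id
| InWeylM a w : rd_root a -> in_weyl w -> in_weyl (coreflection a \o w).

Record weyl := Weyl { weyl_fun :> Mc -> Mc; weylP : in_weyl weyl_fun }.

Lemma weyl_ext (v w : weyl) : v =1 w -> v = w.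
Proof.
case: v w => [v hv] [w hw] /= /funext vw; move: hv hw; rewrite vw => hv hw.
by congr Weyl; apply: Prop_irrelevance.
Qed.

Lemma coreflectionD a : {morph coreflection a : x y / x + y}.
Proof. by move=> x y; rewrite /coreflection rd_pairDr scalerDl opprD addrACA. Qed.

Lemma coreflectionK a : rd_root a -> involutive (coreflection a).
Proof.
move=> ha y; have pZ n : rd_pair a (n *: rd_check a) = n * 2.
  pose p := (fun y => rd_pair a y) : Mc -> int.
  have p0 : p 0 = 0 by apply: (addrI (p 0)); rewrite addr0 -rd_pairDr addr0.
  have pN z : p (- z) = - p z.
    by apply: (addrI (p z)); rewrite subrr -rd_pairDr subrr.
  have pn (m : nat) : p (m%:Z *: rd_check a) = m%:Z * 2.
    elim: m => [|m IH]; first by rewrite scale0r p0 mul0r.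
    by rewrite intS scalerDl scale1r mulrDl mul1r -IH -(rd_pair2 ha); exact: rd_pairDr.
  rewrite -/(p _); case: n => n; first exact: pn.
  by rewrite NegzE scaleNr pN pn mulNr.
rewrite /coreflection.
have -> : rd_pair a (y - rd_pair a y *: rd_check a) = - rd_pair a y.
  rewrite -scaleNr rd_pairDr pZ mulrDr mulr1 addrA subrr; exact: sub0r.
by rewrite scaleNr opprK subrK.
Qed.

Lemma in_weylM v w : in_weyl v -> in_weyl w -> in_weyl (v \o w).
Proof. by elim=> // a {}v ha _ IH hw; apply: InWeylM ha (IH hw). Qed.

Lemma in_weylV w : in_weyl w -> exists2 v, in_weyl v & cancel v w /\ cancel w v.
Proof.
elim=> [|a {}w ha _ [v hv [vK wK]]]; first by exists id => //; exact: InWeyl1.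
exists (v \o (coreflection a \o id)); first exact/in_weylM/InWeylM/InWeyl1.
split=> y /=; last by rewrite (coreflectionK ha) wK.
by rewrite vK (coreflectionK ha).
Qed.

HB.instance Definition _ := gen_eqMixin weyl.
HB.instance Definition _ := gen_choiceMixin weyl.

Definition weyl_one := Weyl InWeyl1.
Definition weyl_mul (v w : weyl) := Weyl (in_weylM (weylP v) (weylP w)).
Definition weyl_inv (w : weyl) : weyl :=
  let: exist2 v hv _ := cid2 (in_weylV (weylP w)) in Weyl hv.

Lemma weyl_invK w : cancel (weyl_inv w) w /\ cancel w (weyl_inv w).
Proof. by rewrite /weyl_inv; case: cid2. Qed.

Lemma weyl_mulA : associative weyl_mul.
Proof. by move=> u v w; apply: weyl_ext. Qed.
Lemma weyl_mul1w : left_id weyl_one weyl_mul.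
Proof. by move=> w; apply: weyl_ext. Qed.
Lemma weyl_mulw1 : right_id weyl_one weyl_mul.
Proof. by move=> w; apply: weyl_ext. Qed.
Lemma weyl_mulVw : left_inverse weyl_one weyl_inv weyl_mul.
Proof. by move=> w; apply: weyl_ext => y /=; exact: (weyl_invK w).2. Qed.
Lemma weyl_mulwV : right_inverse weyl_one weyl_inv weyl_mul.
Proof. by move=> w; apply: weyl_ext => y /=; exact: (weyl_invK w).1. Qed.

HB.instance Definition _ :=
  isGroup.Build weyl weyl_mulA weyl_mul1w weyl_mulw1 weyl_mulVw weyl_mulwV.

Lemma weylD (w : weyl) : {morph w : x y / x + y}.
Proof.
case: w => w /=; elim=> // a {}w _ _ IH x y /=.
by rewrite IH coreflectionD.
Qed.

Lemma weyl_zmod_morphism (w : weyl) : zmod_morphism w.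
Proof.
have w0 : w 0 = 0 by apply: (addrI (w 0)); rewrite addr0 -weylD addr0.
move=> x y; rewrite weylD; congr (_ + _).
by apply: (addrI (w y)); rewrite -weylD !subrr.
Qed.

HB.instance Definition _ (w : weyl) :=
  GRing.isZmodMorphism.Build Mc Mc w (weyl_zmod_morphism w).

End Weyl.

Section WeylTensor.
Variables (Phi : root_datum) (A : zmodType).

Definition weyl_actl (w : weyl Phi) : tensor (rd_Mc Phi) A -> tensor (rd_Mc Phi) A :=
  tensor_map w idfun.
Definition weyl_actr (w : weyl Phi) : tensor A (rd_Mc Phi) -> tensor A (rd_Mc Phi) :=
  tensor_map idfun w.

Definition semidirect : Type := (tensor (rd_Mc Phi) A * weyl Phi)%type.
HB.instance Definition _ := Choice.on semidirect.

Definition sd_one : semidirect := (0, 1%g).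
Definition sd_mul (x y : semidirect) : semidirect :=
  (x.1 + weyl_actl x.2 y.1, (x.2 * y.2)%g).
Definition sd_inv (x : semidirect) : semidirect :=
  (- weyl_actl (x.2^-1)%g x.1, (x.2^-1)%g).

Lemma weyl_actl1 t : weyl_actl 1%g t = t.
Proof. by rewrite -[RHS]tensor_map_id; elim/tensor_ind: t
  => [|x y hx hy|a b]; rewrite /weyl_actl ?tensor_map0 // ?tensor_mapB ?tensor_mapE // hx hy. Qed.

Lemma weyl_actlM v w t : weyl_actl (v * w)%g t = weyl_actl v (weyl_actl w t).
Proof. by apply/esym/tensor_map_comp. Qed.

Lemma weyl_actl0 w : weyl_actl w 0 = 0. Proof. exact: raddf0. Qed.
Lemma weyl_actlD w : {morph weyl_actl w : x y / x + y}. Proof. exact: raddfD. Qed.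

Lemma sd_mulA : associative sd_mul.
Proof.
by move=> x y z; rewrite /sd_mul /= weyl_actlD weyl_actlM addrA mulgA.
Qed.
Lemma sd_mul1 : left_id sd_one sd_mul.
Proof. by case=> t w; rewrite /sd_mul /= weyl_actl1 add0r mul1g. Qed.
Lemma sd_mulx1 : right_id sd_one sd_mul.
Proof. by case=> t w; rewrite /sd_mul /= weyl_actl0 addr0 mulg1. Qed.
Lemma sd_mulV : left_inverse sd_one sd_inv sd_mul.
Proof. by case=> t w; rewrite /sd_mul /= addNr mulVg. Qed.
Lemma sd_mulxV : right_inverse sd_one sd_inv sd_mul.
Proof.
case=> t w; rewrite /sd_mul /= mulgV; congr (_, _).
rewrite -[weyl_actl w (- _)]/(tensor_map w idfun (- _)) raddfN /= -/(weyl_actl w _).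
by rewrite -weyl_actlM mulgV weyl_actl1 subrr.
Qed.

HB.instance Definition _ :=
  isGroup.Build semidirect sd_mulA sd_mul1 sd_mulx1 sd_mulV sd_mulxV.

End WeylTensor.

Record opens (X : topologicalType) := Opens { oset :> set X; oopen : open oset }.

Identity Coercion fun_of_set : set >-> Funclass.

Section Opens.
Variable X : topologicalType.

Definition opensI (U V : opens X) : opens X := Opens (openI (oopen U) (oopen V)).

Lemma opensIl (U V : opens X) : opensI U V `<=` U. Proof. exact: subIsetl. Qed.
Lemma opensIr (U V : opens X) : opensI U V `<=` V. Proof. exact: subIsetr. Qed.

End Opens.

Record presheaf (X : topologicalType) := Presheaf {
  psec :> opens X -> Type;
  pres : forall U V : opens X, V `<=` U -> psec U -> psec V;
  pres_id : forall (U : opens X) (h : U `<=` U) s, pres h s = s;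
  pres_comp : forall (U V W : opens X) (h : V `<=` U) (k : W `<=` V) (l : W `<=` U) s,
    pres k (pres h s) = pres l s
}.

Definition is_sheaf (X : topologicalType) (F : presheaf X) : Prop :=
  forall (U : opens X) (I : Type) (V : I -> opens X) (hV : forall i, V i `<=` U),
    U `<=` \bigcup_i V i ->
  forall s : forall i, F (V i),
    (forall i j, pres (@opensIl X (V i) (V j)) (s i) = pres (@opensIr X (V i) (V j)) (s j)) ->
  exists! t : F U, forall i, pres (hV i) t = s i.

Section Germ.
Variables (X : topologicalType) (F : presheaf X) (x : X).

Record pregerm := PreGerm {
  pg_dom : opens X;
  pg_in : pg_dom x;
  pg_sec : F pg_dom
}.

HB.instance Definition _ := gen_eqMixin pregerm.
HB.instance Definition _ := gen_choiceMixin pregerm.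

Definition germ_eq (a b : pregerm) : Prop :=
  exists (W : opens X) (ha : W `<=` pg_dom a) (hb : W `<=` pg_dom b),
    W x /\ pres ha (pg_sec a) = pres hb (pg_sec b).

Definition germ_rel : rel pregerm := fun a b => `[< germ_eq a b >].

Lemma germ_rel_refl : reflexive germ_rel.
Proof.
move=> a; apply/asboolP; exists (pg_dom a), (@subset_refl _ _), (@subset_refl _ _).
by split; first exact: pg_in.
Qed.

Lemma germ_rel_sym : symmetric germ_rel.
Proof.
move=> a b; apply/asboolP/asboolP => -[W [ha [hb [Wx e]]]];
  by exists W, hb, ha.
Qed.

Lemma germ_rel_trans : transitive germ_rel.
Proof.
move=> b a c /asboolP[V [va [vb [Vx ev]]]] /asboolP[W [wb [wc [Wx ew]]]].
apply/asboolP; exists (opensI V W).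
exists (subset_trans (@opensIl _ V W) va), (subset_trans (@opensIr _ V W) wc).
split=> //.
rewrite -(pres_comp va (@opensIl _ V W)) ev -(pres_comp wc (@opensIr _ V W)) -ew.
by rewrite !(pres_comp _ _ (subset_trans (@opensIl _ V W) vb)).
Qed.

Canonical germ_equiv := EquivRel germ_rel germ_rel_refl germ_rel_sym germ_rel_trans.

Definition germ : Type := {eq_quot germ_rel}.
HB.instance Definition _ := Choice.on germ.

Definition germ_of (U : opens X) (h : U x) (s : F U) : germ :=
  \pi_{eq_quot germ_rel} (PreGerm h s).

Lemma germ_ofP (U V : opens X) (hU : U x) (hV : V x) (s : F U) (t : F V) :
  germ_of hU s = germ_of hV t <->
  exists (W : opens X) (ha : W `<=` U) (hb : W `<=` V),
    W x /\ pres ha s = pres hb t.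
Proof. by split=> [/eqmodP/asboolP|h]; last exact/eqmodP/asboolP. Qed.

Lemma germ_of_res (U V : opens X) (k : V `<=` U) (hU : U x) (hV : V x) (s : F U) :
  germ_of hV (pres k s) = germ_of hU s.
Proof.
apply/germ_ofP; exists V, (@subset_refl _ _), k; split=> //.
by rewrite (pres_comp _ _ k).
Qed.

Lemma germ_elim (g : germ) : exists (U : opens X) (h : U x) (s : F U), g = germ_of h s.
Proof.
exists (pg_dom (repr (g : {eq_quot germ_rel}))), (pg_in _), (pg_sec _).
by rewrite /germ_of; case: repr (reprK (g : {eq_quot germ_rel})).
Qed.

End Germ.

Section Sheafify.
Variables (X : topologicalType) (F : presheaf X).

Definition locally_section (U : opens X) (s : forall x, U x -> germ F x) : Prop :=
  forall x, U x -> exists (V : opens X) (hV : V `<=` U) (t : F V),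
    V x /\ forall y (Vy : V y), s y (hV y Vy) = germ_of Vy t.

Record shsec (U : opens X) := ShSec {
  sh_germ :> forall x, U x -> germ F x;
  sh_loc : locally_section sh_germ
}.

Lemma shsec_ext (U : opens X) (s t : shsec U) :
  (forall x (Ux : U x), s x Ux = t x Ux) -> s = t.
Proof.
case: s t => [s hs] [t ht] /= st.
have {}st : s = t by apply/functional_extensionality_dep => x; apply/funext => Ux.
by move: hs ht; rewrite st => hs ht; congr ShSec; apply: Prop_irrelevance.
Qed.

Lemma shsec_irr (U : opens X) (s : shsec U) x (h k : U x) : s x h = s x k.
Proof. by congr (s x); apply: Prop_irrelevance. Qed.

Lemma shres_loc (U V : opens X) (h : V `<=` U) (s : shsec U) :
  locally_section (fun x Vx => s x (h x Vx)).
Proof.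
move=> x Vx; have [W [hW [t [Wx e]]]] := sh_loc s (h x Vx).
exists (opensI W V), (@opensIr _ W V), (pres (@opensIl _ W V) t); split=> // y Wy.
rewrite (germ_of_res _ (@opensIl _ W V y Wy)) -e; exact: shsec_irr.
Qed.

Definition shres (U V : opens X) (h : V `<=` U) (s : shsec U) : shsec V :=
  ShSec (shres_loc h s).

Lemma shres_id (U : opens X) (h : U `<=` U) s : shres h s = s.
Proof. by apply: shsec_ext => x Ux /=; apply: shsec_irr. Qed.

Lemma shres_comp (U V W : opens X) (h : V `<=` U) (k : W `<=` V) (l : W `<=` U) s :
  shres k (shres h s) = shres l s.
Proof. by apply: shsec_ext => x Ux /=; apply: shsec_irr. Qed.

Definition sheafify : presheaf X := Presheaf shres_id shres_comp.

Lemma sheafify_is_sheaf : is_sheaf sheafify.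
Proof.
move=> U I V hV cov s compat.
have ch x (Ux : U x) : {i | V i x} by apply: cid; have [i _ Vx] := cov x Ux; exists i.
have glue i j x (hi : V i x) (hj : V j x) : s i x hi = s j x hj.
  have := congr1 (fun t : shsec (opensI (V i) (V j)) => t x (conj hi hj)) (compat i j).
  by rewrite /= (shsec_irr (s i) _ hi) (shsec_irr (s j) _ hj).
pose t x (Ux : U x) := s (sval (ch x Ux)) x (svalP (ch x Ux)).
have tloc : locally_section t.
  move=> x Ux; case: (ch x Ux) => i Vx.
  have [W [hW [r [Wx e]]]] := sh_loc (s i) Vx.
  exists W, (subset_trans hW (hV i)), r; split=> // y Wy.
  by rewrite -e; exact: glue.
exists (ShSec tloc); split=> [i|u hu].
  by apply: shsec_ext => x Vx; exact: glue.
apply: shsec_ext => x Ux /=; rewrite /t; case: (ch x Ux) => i Vx /=.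
by rewrite -(hu i) /=; exact: shsec_irr.
Qed.

Lemma sh_unit_loc (U : opens X) (s : F U) :
  locally_section (fun x (Ux : U x) => germ_of Ux s).
Proof.
move=> x Ux; exists U, (@subset_refl _ _), s; split=> // y Uy.
by congr germ_of; apply: Prop_irrelevance.
Qed.

Definition sh_unit (U : opens X) (s : F U) : sheafify U := ShSec (sh_unit_loc s).

End Sheafify.

Section SheafifyMap.
Variables (X : topologicalType) (F G : presheaf X) (f : forall U : opens X, F U -> G U).
Hypothesis f_res : forall (U V : opens X) (h : V `<=` U) (s : F U), f (pres h s) = pres h (f s).

Definition germ_map x (g : germ F x) : germ G x :=
  let a := repr (g : {eq_quot @germ_rel X F x}) in
  germ_of (pg_in a) (f (pg_sec a)).

Lemma germ_mapE x (U : opens X) (Ux : U x) (s : F U) :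
  germ_map (germ_of Ux s) = germ_of Ux (f s).
Proof.
rewrite /germ_map; case: piP => -[V Vx t] /germ_ofP[W [hU [hV [Wx e]]]] /=.
by apply/germ_ofP; exists W, hV, hU; split=> //; rewrite -!f_res e.
Qed.

Lemma sheafify_map_loc (U : opens X) (s : sheafify F U) :
  locally_section (fun x (Ux : U x) => germ_map (s x Ux)).
Proof.
move=> x Ux; have [V [hV [t [Vx e]]]] := sh_loc s Ux.
by exists V, hV, (f t); split=> // y Vy; rewrite e germ_mapE.
Qed.

Definition sheafify_map (U : opens X) (s : sheafify F U) : sheafify G U :=
  ShSec (sheafify_map_loc s).

Lemma sheafify_map_res (U V : opens X) (h : V `<=` U) (s : sheafify F U) :
  sheafify_map (pres h s) = pres h (sheafify_map s).
Proof. exact: shsec_ext. Qed.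

End SheafifyMap.

Record gpresheaf (X : topologicalType) := GPresheaf {
  gsec :> opens X -> groupType;
  gres : forall U V : opens X, V `<=` U -> gsec U -> gsec V;
  gresM : forall (U V : opens X) (h : V `<=` U), {morph gres h : s t / (s * t)%g};
  gres_id : forall (U : opens X) (h : U `<=` U) s, gres h s = s;
  gres_comp : forall (U V W : opens X) (h : V `<=` U) (k : W `<=` V) (l : W `<=` U) s,
    gres k (gres h s) = gres l s
}.

Definition gpre (X : topologicalType) (G : gpresheaf X) : presheaf X :=
  @Presheaf X (fun U => G U) (@gres X G) (@gres_id X G) (@gres_comp X G).

Lemma gres1 X (G : gpresheaf X) (U V : opens X) (h : V `<=` U) : gres h (1%g : G U) = 1%g.
Proof. by apply: (mulgI (gres h 1%g)); rewrite -gresM !mulg1. Qed.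

Lemma gresV X (G : gpresheaf X) (U V : opens X) (h : V `<=` U) (s : G U) :
  gres h (s^-1)%g = (gres h s)^-1%g.
Proof. by apply: (mulgI (gres h s)); rewrite -gresM !mulgV gres1. Qed.

Record ghom (X : topologicalType) (G K : gpresheaf X) := GHom {
  ghom_fun :> forall U, G U -> K U;
  ghomM : forall U, {morph @ghom_fun U : s t / (s * t)%g};
  ghom_res : forall (U V : opens X) (h : V `<=` U) s, ghom_fun (gres h s) = gres h (ghom_fun s)
}.

Section GermGroup.
Variables (X : topologicalType) (G : gpresheaf X) (x : X).
Notation germ := (germ (gpre G) x).
Notation gof Ux s := (@germ_of X (gpre G) x _ Ux s).

Definition germ_one : germ := @germ_of X (gpre G) x (Opens openT) I 1%g.

Definition germ_mul (a b : germ) : germ :=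
  let a' := repr (a : {eq_quot @germ_rel X (gpre G) x}) in
  let b' := repr (b : {eq_quot @germ_rel X (gpre G) x}) in
  @germ_of X (gpre G) x (opensI (pg_dom a') (pg_dom b')) (conj (pg_in a') (pg_in b'))
    (gres (@opensIl X _ _) (pg_sec a') * gres (@opensIr X _ _) (pg_sec b'))%g.

Definition germ_inv : germ -> germ :=
  germ_map (F := gpre G) (G := gpre G) (fun U (s : G U) => (s^-1)%g) (x := x).

Lemma germ_mulE (U : opens X) (Ux : U x) (s t : G U) :
  germ_mul (gof Ux s) (gof Ux t) = gof Ux (s * t)%g.
Proof.
rewrite /germ_mul; case: piP => -[V Vx s'] /germ_ofP[V' [hV1 [hV2 [V'x eV]]]].
case: piP => -[W Wx t'] /germ_ofP[W' [hW1 [hW2 [W'x eW]]]] /=.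
apply/germ_ofP; exists (opensI V' W').
have h1 : opensI V' W' `<=` opensI V W by move=> y [/hV2 ? /hW2].
have h2 : opensI V' W' `<=` U by move=> y [/hV1].
exists h1, h2; split=> //=; rewrite !gresM.
have -> : gres h1 (gres (@opensIl X V W) s') = gres h2 s.
  rewrite (gres_comp _ _ (subset_trans (@opensIl _ V' W') hV2)).
  rewrite -(gres_comp hV2 (@opensIl _ V' W')) -[gres hV2 s']eV.
  by rewrite /= (gres_comp _ _ h2).
congr (_ * _)%g.
rewrite (gres_comp _ _ (subset_trans (@opensIr _ V' W') hW2)).
rewrite -(gres_comp hW2 (@opensIr _ V' W')) -[gres hW2 t']eW.
by rewrite /= (gres_comp _ _ h2).
Qed.

Lemma germ_invE (U : opens X) (Ux : U x) (s : G U) :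
  germ_inv (gof Ux s) = gof Ux (s^-1)%g.
Proof. by apply: germ_mapE => V W h t; rewrite /= gresV. Qed.

Lemma germ_oneE (U : opens X) (Ux : U x) : germ_one = gof Ux (1%g : G U).
Proof.
apply/germ_ofP; exists U, (@subsetT _ U), (@subset_refl _ U); split=> //=.
by rewrite !gres1.
Qed.

Lemma germ_elim2 (a b : germ) : exists (U : opens X) (h : U x) (s t : G U),
  a = gof h s /\ b = gof h t.
Proof.
have [U [Ux [s ->]]] := germ_elim a; have [V [Vx [t ->]]] := germ_elim b.
exists (opensI U V), (conj Ux Vx), (gres (@opensIl X _ _) s), (gres (@opensIr X _ _) t).
by split; apply/esym/(@germ_of_res X (gpre G)).
Qed.

Lemma germ_mulA : associative germ_mul.
Proof.
move=> a b c; have [U [Ux [s [t [-> ->]]]]] := germ_elim2 a b.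
have [V [Vx [r ->]]] := germ_elim c.
have E := @germ_of_res X (gpre G) x _ _ _ _ (conj Ux Vx : opensI U V x).
rewrite -(E _ (@opensIl _ U V) Ux s) -(E _ (@opensIl _ U V) Ux t).
rewrite -(E _ (@opensIr _ U V) Vx r).
by rewrite !germ_mulE mulgA.
Qed.

Lemma germ_mul1 : left_id germ_one germ_mul.
Proof. by move=> a; have [U [Ux [s ->]]] := germ_elim a; rewrite (germ_oneE Ux) germ_mulE mul1g. Qed.
Lemma germ_mulx1 : right_id germ_one germ_mul.
Proof. by move=> a; have [U [Ux [s ->]]] := germ_elim a; rewrite (germ_oneE Ux) germ_mulE mulg1. Qed.
Lemma germ_mulV : left_inverse germ_one germ_inv germ_mul.
Proof.
move=> a; have [U [Ux [s ->]]] := germ_elim a.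
by rewrite (germ_oneE Ux) germ_invE germ_mulE mulVg.
Qed.
Lemma germ_mulxV : right_inverse germ_one germ_inv germ_mul.
Proof.
move=> a; have [U [Ux [s ->]]] := germ_elim a.
by rewrite (germ_oneE Ux) germ_invE germ_mulE mulgV.
Qed.

End GermGroup.

Section GSheafify.
Variables (X : topologicalType) (G : gpresheaf X).

Section Sections.
Variable U : opens X.

Definition gshsec : Type := shsec (gpre G) U.
HB.instance Definition _ := gen_eqMixin gshsec.
HB.instance Definition _ := gen_choiceMixin gshsec.

Lemma gsh_one_loc : @locally_section X (gpre G) U (fun x (Ux : U x) => germ_one G x).
Proof.
move=> x Ux; exists U, (@subset_refl _ _), (1%g : G U); split=> // y Uy.
exact: germ_oneE.
Qed.

Lemma gsh_mul_loc (s t : gshsec) :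
  @locally_section X (gpre G) U (fun x (Ux : U x) => germ_mul (s x Ux) (t x Ux)).
Proof.
move=> x Ux; have [V [hV [s' [Vx es]]]] := sh_loc s Ux.
have [W [hW [t' [Wx et]]]] := sh_loc t Ux.
exists (opensI V W), (subset_trans (@opensIl _ V W) hV).
exists (gres (@opensIl _ V W) s' * gres (@opensIr _ V W) t')%g; split=> // y VWy.
rewrite -germ_mulE; congr germ_mul.
  rewrite (@germ_of_res _ (gpre G) _ _ _ _ (opensIl VWy)) -es; exact: shsec_irr.
rewrite (@germ_of_res _ (gpre G) _ _ _ _ (opensIr VWy)) -et; exact: shsec_irr.
Qed.

Lemma gsh_inv_loc (s : gshsec) :
  @locally_section X (gpre G) U (fun x (Ux : U x) => germ_inv (s x Ux)).
Proof.
move=> x Ux; have [V [hV [s' [Vx es]]]] := sh_loc s Ux.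
exists V, hV, ((s' : G V)^-1)%g; split=> // y Vy; rewrite es; exact: germ_invE.
Qed.

Definition gsh_one : gshsec := ShSec gsh_one_loc.
Definition gsh_mul (s t : gshsec) : gshsec := ShSec (gsh_mul_loc s t).
Definition gsh_inv (s : gshsec) : gshsec := ShSec (gsh_inv_loc s).

Lemma gsh_mulA : associative gsh_mul.
Proof. by move=> r s t; apply: shsec_ext => x Ux; exact: germ_mulA. Qed.
Lemma gsh_mul1 : left_id gsh_one gsh_mul.
Proof. by move=> s; apply: shsec_ext => x Ux; exact: germ_mul1. Qed.
Lemma gsh_mulx1 : right_id gsh_one gsh_mul.
Proof. by move=> s; apply: shsec_ext => x Ux; exact: germ_mulx1. Qed.
Lemma gsh_mulV : left_inverse gsh_one gsh_inv gsh_mul.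
Proof. by move=> s; apply: shsec_ext => x Ux; exact: germ_mulV. Qed.
Lemma gsh_mulxV : right_inverse gsh_one gsh_inv gsh_mul.
Proof. by move=> s; apply: shsec_ext => x Ux; exact: germ_mulxV. Qed.

HB.instance Definition _ :=
  isGroup.Build gshsec gsh_mulA gsh_mul1 gsh_mulx1 gsh_mulV gsh_mulxV.

End Sections.

Lemma gsh_resM (U V : opens X) (h : V `<=` U) :
  {morph (@pres X (sheafify (gpre G)) U V h : gshsec U -> gshsec V) : s t / (s * t)%g}.
Proof. by move=> s t; apply: shsec_ext. Qed.

Definition gsheafify : gpresheaf X :=
  @GPresheaf X (fun U => gshsec U) _ gsh_resM
    (@pres_id _ (sheafify (gpre G))) (@pres_comp _ (sheafify (gpre G))).

Definition gsh_unit (U : opens X) (s : G U) : gsheafify U := @sh_unit X (gpre G) U s.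

End GSheafify.

Section GSheafifyHom.
Variables (X : topologicalType) (G K : gpresheaf X) (f : ghom G K).

Definition gsheafify_fun (U : opens X) : gsheafify G U -> gsheafify K U :=
  @sheafify_map X (gpre G) (gpre K) f (@ghom_res X G K f) U.

Lemma gsheafify_funM (U : opens X) : {morph @gsheafify_fun U : s t / (s * t)%g}.
Proof.
move=> s t; apply: shsec_ext => x Ux /=.
have [V [Vx [a [b [-> ->]]]]] := germ_elim2 (s x Ux) (t x Ux).
have E := @germ_mapE X (gpre G) (gpre K) f (@ghom_res X G K f) x V Vx.
by rewrite germ_mulE !E germ_mulE ghomM.
Qed.

Definition gsheafify_hom : ghom (gsheafify G) (gsheafify K) :=
  @GHom X (gsheafify G) (gsheafify K) gsheafify_fun gsheafify_funM
    (@sheafify_map_res X (gpre G) (gpre K) f (@ghom_res X G K f)).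

End GSheafifyHom.

Definition const_gpresheaf (X : topologicalType) (W : groupType) : gpresheaf X :=
  @GPresheaf X (fun=> W) (fun _ _ _ w => w) (fun _ _ _ _ _ => erefl)
    (fun _ _ _ => erefl) (fun _ _ _ _ _ _ _ => erefl).

(* Sheaves of groups act from the right. *)
Record gspace (X : topologicalType) (G : gpresheaf X) := GSpace {
  gs_presheaf :> presheaf X;
  gact : forall U : opens X, gs_presheaf U -> G U -> gs_presheaf U;
  gact1 : forall (U : opens X) (s : gs_presheaf U), gact s 1%g = s;
  gactM : forall (U : opens X) (s : gs_presheaf U) (g h : G U),
    gact s (g * h)%g = gact (gact s g) h;
  gact_res : forall (U V : opens X) (k : V `<=` U) (s : gs_presheaf U) (g : G U),
    pres k (gact s g) = gact (pres k s) (gres k g)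
}.

Section Spaces.
Variables (X : topologicalType) (G : gpresheaf X).

Record gmap (P Q : gspace G) := GMap {
  gmap_fun :> forall U : opens X, P U -> Q U;
  gmap_res : forall (U V : opens X) (k : V `<=` U) (s : P U),
    gmap_fun (pres k s) = pres k (gmap_fun s);
  gmap_act : forall (U : opens X) (s : P U) (g : G U),
    gmap_fun (gact s g) = gact (gmap_fun s) g
}.

Record giso (P Q : gspace G) := GIso {
  giso_map :> gmap P Q;
  giso_bij : forall U : opens X, bijective (giso_map U)
}.

Definition is_torsor (P : gspace G) : Prop :=
  [/\ is_sheaf P,
      forall x, exists U : opens X, U x /\ inhabited (P U)
    & forall (U : opens X) (s t : P U), exists! g : G U, gact s g = t].

Record torsor := Torsor {
  torsor_space :> gspace G;
  torsorP : is_torsor torsor_space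
}.

Definition gself : gspace G :=
  @GSpace X G (gpre G) (fun U (s g : G U) => (s * g)%g)
    (fun U s => mulg1 s) (fun U s g h => mulgA s g h)
    (fun U V k s g => gresM k s g).

End Spaces.

Lemma gself_torsor (X : topologicalType) (G : gpresheaf X) :
  is_torsor (gself (gsheafify G)).
Proof.
split=> [|x|U s t]; first exact: sheafify_is_sheaf.
  by exists (Opens openT); split=> //; exact: (inhabits (1%g : gsheafify G _)).
exists (s^-1 * t : gsheafify G U)%g; split=> /= [|g <-].
  by rewrite mulgA mulgV mul1g.
by rewrite mulgA mulVg mul1g.
Qed.

Definition trivial_torsor (X : topologicalType) (G : gpresheaf X) :
  torsor (gsheafify G) := Torsor (gself_torsor G).

Section SheafifySpace.
Variables (X : topologicalType) (K : gpresheaf X) (Q : gspace K).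

Section GermAct.
Variables (U : opens X) (x : X) (Ux : U x).

Definition germ_act (a : germ Q x) (k : K U) : germ Q x :=
  let a' := repr (a : {eq_quot @germ_rel X Q x}) in
  @germ_of X Q x (opensI (pg_dom a') U) (conj (pg_in a') Ux)
    (gact (pres (@opensIl X _ _) (pg_sec a')) (gres (@opensIr X _ _) k)).

Lemma germ_actE (V : opens X) (Vx : V x) (s : Q V) (k : K U) (W : opens X)
    (Wx : W x) (hV : W `<=` V) (hU : W `<=` U) :
  germ_act (germ_of Vx s) k = germ_of Wx (gact (pres hV s) (gres hU k)).
Proof.
rewrite /germ_act; case: piP => -[V' V'x s'] /germ_ofP[T [h1 [h2 [Tx e]]]] /=.
apply/germ_ofP; exists (opensI T W).
have k1 : opensI T W `<=` opensI V' U by move=> y [/h2 ? /hU].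
have k2 : opensI T W `<=` W by move=> y [].
exists k1, k2; split=> //; rewrite !gact_res.
rewrite (gres_comp _ _ (subset_trans k2 hU)) (gres_comp _ _ (subset_trans k2 hU)).
congr gact.
rewrite (pres_comp _ _ (subset_trans (@opensIl _ T W) h2)).
rewrite -(pres_comp h2 (@opensIl _ T W)) -e.
by rewrite !(pres_comp _ _ (subset_trans k2 hV)).
Qed.

End GermAct.

Lemma sh_act_loc (U : opens X) (s : sheafify Q U) (k : K U) :
  locally_section (fun x (Ux : U x) => germ_act Ux (s x Ux) k).
Proof.
move=> x Ux; have [V [hV [t [Vx e]]]] := sh_loc s Ux.
exists V, hV, (gact t (gres hV k)); split=> // y Vy.
by rewrite e (germ_actE _ _ _ _ Vy (@subset_refl _ _) hV) pres_id.
Qed.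

Definition sh_act (U : opens X) (s : sheafify Q U) (k : K U) : sheafify Q U :=
  ShSec (sh_act_loc s k).

Lemma sh_act1 (U : opens X) (s : sheafify Q U) : sh_act s 1%g = s.
Proof.
apply: shsec_ext => x Ux /=; have [V [Vx [t ->]]] := germ_elim (s x Ux).
rewrite (germ_actE _ _ _ _ (conj Vx Ux : opensI V U x) (@opensIl _ V U) (@opensIr _ V U)).
by rewrite gres1 gact1; exact: germ_of_res.
Qed.

Lemma sh_actM (U : opens X) (s : sheafify Q U) (g h : K U) :
  sh_act s (g * h)%g = sh_act (sh_act s g) h.
Proof.
apply: shsec_ext => x Ux /=; have [V [Vx [t ->]]] := germ_elim (s x Ux).
pose Wx := conj Vx Ux : opensI V U x.
rewrite !(germ_actE _ _ _ _ Wx (@opensIl _ V U) (@opensIr _ V U)).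
rewrite (germ_actE _ _ _ _ Wx (@subset_refl _ _) (@opensIr _ V U)).
by rewrite pres_id gresM gactM.
Qed.

Lemma sh_act_res (U V : opens X) (k : V `<=` U) (s : sheafify Q U) (g : K U) :
  pres k (sh_act s g) = sh_act (pres k s) (gres k g).
Proof.
apply: shsec_ext => x Vx /=; have [W [Wx [t ->]]] := germ_elim (s x (k x Vx)).
pose Tx := conj Wx Vx : opensI W V x.
rewrite (germ_actE _ _ _ _ Tx (@opensIl _ W V) (subset_trans (@opensIr _ W V) k)).
rewrite (germ_actE _ _ _ _ Tx (@opensIl _ W V) (@opensIr _ W V)).
by rewrite (gres_comp _ _ (subset_trans (@opensIr _ W V) k)).
Qed.

Definition sheafify_gspace : gspace K := GSpace sh_act1 sh_actM sh_act_res.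

End SheafifySpace.

(* For [pi : G -> K] and a [G]-space [P], [push pi P] is the contracted product
   [P ×^G K], i.e. the sheafification of [U |-> (P U * K U) / G U], where [g]
   acts by [(p, k) |-> (p g, pi(g)^-1 k)]. *)

Section Push.
Variables (X : topologicalType) (G K : gpresheaf X) (pi : ghom G K).

Section Quotient.
Variable P : gspace G.

Definition push_pair (U : opens X) : Type := (P U * K U)%type.
HB.instance Definition _ U := gen_eqMixin (push_pair U).
HB.instance Definition _ U := gen_choiceMixin (push_pair U).

Definition push_rel (U : opens X) : rel (push_pair U) :=
  fun a b => `[< exists g : G U, b = (gact a.1 g, (pi U g)^-1 * a.2)%g >].

Lemma push_rel_refl (U : opens X) : reflexive (@push_rel U).
Proof.
move=> [p k]; apply/asboolP; exists 1%g => /=.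
have pi1 : pi U 1%g = 1%g.
  by apply: (mulgI (pi U 1%g)); rewrite -ghomM !mulg1.
by rewrite gact1 pi1 invg1 mul1g.
Qed.

Lemma push_rel_sym (U : opens X) : symmetric (@push_rel U).
Proof.
have half a b : @push_rel U a b -> push_rel b a.
  case: a => p k /asboolP[g ->]; apply/asboolP; exists (g^-1)%g => /=.
  rewrite -gactM mulgV gact1 mulgA -invgM -ghomM mulgV.
  have -> : pi U 1%g = 1%g.
    by apply: (mulgI (pi U 1%g)); rewrite -ghomM !mulg1.
  by rewrite invg1 mul1g.
by move=> a b; apply/idP/idP => /half.
Qed.

Lemma push_rel_trans (U : opens X) : transitive (@push_rel U).
Proof.
move=> b a c /asboolP[g ->] /asboolP[h ->]; apply/asboolP.
by exists (g * h)%g; rewrite /= gactM ghomM invgM mulgA.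
Qed.

Canonical push_equiv U :=
  EquivRel (@push_rel U) (@push_rel_refl U) (@push_rel_sym U) (@push_rel_trans U).

Definition push_quot (U : opens X) : Type := {eq_quot @push_rel U}.

Definition push_class (U : opens X) (p : P U) (k : K U) : push_quot U :=
  \pi_{eq_quot @push_rel U} ((p, k) : push_pair U).

Lemma push_classP (U : opens X) (p p' : P U) (k k' : K U) :
  push_class p k = push_class p' k' <->
  exists g : G U, p' = gact p g /\ k' = ((pi U g)^-1 * k)%g.
Proof.
split=> [/eqmodP/asboolP[g [-> ->]]|[g [-> ->]]]; first by exists g.
by apply/eqmodP/asboolP; exists g.
Qed.

Lemma push_quot_elim (U : opens X) (q : push_quot U) :
  exists p k, q = push_class p k.
Proof.
rewrite -[q]reprK; case: (repr _) => p k.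
by exists p, k.
Qed.

Definition push_res (U V : opens X) (h : V `<=` U) (q : push_quot U) : push_quot V :=
  let a := repr (q : {eq_quot @push_rel U}) in
  push_class (pres h a.1) (gres h a.2).

Lemma push_resE (U V : opens X) (h : V `<=` U) (p : P U) (k : K U) :
  push_res h (push_class p k) = push_class (pres h p) (gres h k).
Proof.
rewrite /push_res; case: piP => -[p' k'] /push_classP[g [-> ->]] /=.
apply/esym/push_classP; exists (gres h g).
by rewrite gact_res gresM gresV ghom_res.
Qed.

Lemma push_res_id (U : opens X) (h : U `<=` U) (q : push_quot U) : push_res h q = q.
Proof. by have [p [k ->]] := push_quot_elim q; rewrite push_resE pres_id gres_id. Qed.

Lemma push_res_comp (U V W : opens X) (h : V `<=` U) (k : W `<=` V) (l : W `<=` U)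
    (q : push_quot U) : push_res k (push_res h q) = push_res l q.
Proof.
have [p [g ->]] := push_quot_elim q.
by rewrite !push_resE (pres_comp _ _ l) (gres_comp _ _ l).
Qed.

Definition push_act (U : opens X) (q : push_quot U) (k : K U) : push_quot U :=
  let a := repr (q : {eq_quot @push_rel U}) in push_class a.1 (a.2 * k)%g.

Lemma push_actE (U : opens X) (p : P U) (k l : K U) :
  push_act (push_class p k) l = push_class p (k * l)%g.
Proof.
rewrite /push_act; case: piP => -[p' k'] /push_classP[g [-> ->]] /=.
by apply/esym/push_classP; exists g; rewrite mulgA.
Qed.

Lemma push_act1 (U : opens X) (q : push_quot U) : push_act q 1%g = q.
Proof. by have [p [k ->]] := push_quot_elim q; rewrite push_actE mulg1. Qed.

Lemma push_actM (U : opens X) (q : push_quot U) (g h : K U) :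
  push_act q (g * h)%g = push_act (push_act q g) h.
Proof. by have [p [k ->]] := push_quot_elim q; rewrite !push_actE mulgA. Qed.

Lemma push_act_res (U V : opens X) (h : V `<=` U) (q : push_quot U) (k : K U) :
  push_res h (push_act q k) = push_act (push_res h q) (gres h k).
Proof.
by have [p [l ->]] := push_quot_elim q; rewrite push_resE !push_actE push_resE gresM.
Qed.

Definition push_presheaf : gspace K :=
  @GSpace X K (@Presheaf X push_quot push_res push_res_id push_res_comp)
    push_act push_act1 push_actM push_act_res.

Definition push : gspace K := sheafify_gspace push_presheaf.

Definition push_section (U : opens X) (p : P U) : push U :=
  @sh_unit X push_presheaf U (push_class p 1%g).

End Quotient.

Section Functor.
Variables (P P' : gspace G) (f : gmap P P').

Definition push_quot_map (U : opens X) (q : push_presheaf P U) : push_presheaf P' U :=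
  let a := repr (q : {eq_quot @push_rel P U}) in push_class (f U a.1) a.2.

Lemma push_quot_mapE (U : opens X) (p : P U) (k : K U) :
  push_quot_map (push_class p k) = push_class (f U p) k.
Proof.
rewrite /push_quot_map; case: piP => -[p' k'] /push_classP[g [-> ->]] /=.
by apply/esym/push_classP; exists g; rewrite gmap_act.
Qed.

Lemma push_quot_map_res (U V : opens X) (h : V `<=` U) (q : push_presheaf P U) :
  push_quot_map (pres h q) = pres h (push_quot_map q).
Proof.
have [p [k ->]] := push_quot_elim q.
by rewrite push_quot_mapE /= !push_resE push_quot_mapE gmap_res.
Qed.

Lemma push_quot_map_act (U : opens X) (q : push_presheaf P U) (k : K U) :
  push_quot_map (gact q k) = gact (push_quot_map q) k.
Proof.
have [p [l ->]] := push_quot_elim q.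
by rewrite push_quot_mapE /= !push_actE push_quot_mapE.
Qed.

Definition push_fun (U : opens X) : push P U -> push P' U :=
  sheafify_map push_quot_map_res (U := U).

Lemma push_fun_act (U : opens X) (s : push P U) (k : K U) :
  push_fun (gact s k) = gact (push_fun s) k.
Proof.
apply: shsec_ext => x Ux /=; have [V [Vx [t ->]]] := germ_elim (s x Ux).
pose Wx := conj Vx Ux : opensI V U x.
rewrite (germ_actE _ _ _ _ Wx (@opensIl _ V U) (@opensIr _ V U)).
rewrite !(germ_mapE push_quot_map_res).
rewrite (germ_actE _ _ _ _ Wx (@opensIl _ V U) (@opensIr _ V U)).
by rewrite push_quot_map_act push_quot_map_res.
Qed.

Definition push_map : gmap (push P) (push P') :=
  @GMap X K (push P) (push P') push_fun (sheafify_map_res push_quot_map_res)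
    push_fun_act.

End Functor.
End Push.

Record abpresheaf (X : topologicalType) := AbPresheaf {
  asec :> opens X -> zmodType;
  ares : forall U V : opens X, V `<=` U -> {additive asec U -> asec V};
  ares_id : forall (U : opens X) (h : U `<=` U) s, ares h s = s;
  ares_comp : forall (U V W : opens X) (h : V `<=` U) (k : W `<=` V) (l : W `<=` U) s,
    ares k (ares h s) = ares l s
}.

(* Following Godement, covers are indexed by the points of the space, with [x]
   in the member of index [x]; they are cofinal among all open covers and are
   directed under pointwise inclusion, so that H^1 is a genuine colimit. *)
Record pt_cover (X : topologicalType) := Cover {
  cov :> X -> opens X;
  covP : forall x, cov x x
}.

Section AbRes.
Variables (X : topologicalType) (F : abpresheaf X) (U V : opens X) (h : V `<=` U).

Lemma ares0 : ares F h 0 = 0. Proof. exact: raddf0. Qed.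
Lemma aresN : {morph ares F h : s / - s}. Proof. exact: raddfN. Qed.
Lemma aresD : {morph ares F h : s t / s + t}. Proof. exact: raddfD. Qed.

End AbRes.

Section Cech.
Variables (X : topologicalType) (F : abpresheaf X).

Record cocycle (U : pt_cover X) := Cocycle {
  cocycle_fun :> forall x y, F (opensI (U x) (U y));
  cocycleP : forall x y z (W : opens X) (hxy : W `<=` opensI (U x) (U y))
      (hyz : W `<=` opensI (U y) (U z)) (hxz : W `<=` opensI (U x) (U z)),
    ares F hxy (cocycle_fun x y) + ares F hyz (cocycle_fun y z) =
    ares F hxz (cocycle_fun x z)
}.

Record precech := PreCech { cech_cover : pt_cover X; cech_cocycle : cocycle cech_cover }.

HB.instance Definition _ := gen_eqMixin precech.
HB.instance Definition _ := gen_choiceMixin precech.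

Definition cohomologous (a b : precech) : Prop :=
  exists (W : pt_cover X) (f : forall x, F (W x)),
    (forall x, W x `<=` cech_cover a x /\ W x `<=` cech_cover b x) /\
    forall x y (T : opens X) (hx : T `<=` W x) (hy : T `<=` W y)
      (ha : T `<=` opensI (cech_cover a x) (cech_cover a y))
      (hb : T `<=` opensI (cech_cover b x) (cech_cover b y)),
      ares F hb (cech_cocycle b x y) =
      ares F ha (cech_cocycle a x y) + (ares F hy (f y) - ares F hx (f x)).

Definition cohomologous_rel : rel precech := fun a b => `[< cohomologous a b >].

Definition coverI (U V : pt_cover X) : pt_cover X :=
  Cover (cov := fun x => opensI (U x) (V x)) (fun x => conj (covP U x) (covP V x)).

Lemma cohomologous_refl : reflexive cohomologous_rel.
Proof.
move=> a; apply/asboolP; exists (cech_cover a), (fun=> 0).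
split=> [x|x y T hx hy ha hb]; first by split; exact: subset_refl.
rewrite !ares0 subrr addr0; congr (ares F _ _); apply: Prop_irrelevance.
Qed.

Lemma cohomologous_sym : symmetric cohomologous_rel.
Proof.
have half a b : cohomologous_rel a b -> cohomologous_rel b a.
  move=> /asboolP[W [f [sub e]]]; apply/asboolP; exists W, (fun x => - f x).
  split=> [x|x y T hx hy ha hb]; first by have [] := sub x.
  by rewrite (e x y T hx hy hb ha) !aresN /= -addrA addrACA !subrr !addr0.
by move=> a b; apply/idP/idP => /half.
Qed.

Lemma cohomologous_trans : transitive cohomologous_rel.
Proof.
move=> b a c /asboolP[V [f [subV eV]]] /asboolP[W [g [subW eW]]]; apply/asboolP.
exists (coverI V W), (fun x => ares F (@opensIl _ _ _) (f x) + ares F (@opensIr _ _ _) (g x)).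
split=> [x|x y T hx hy ha hc].
  by split=> z [Vz Wz]; [have [+ _] := subV x; exact|have [_ +] := subW x; exact].
have hVx : T `<=` V x by move=> z /hx[].
have hVy : T `<=` V y by move=> z /hy[].
have hWx : T `<=` W x by move=> z /hx[].
have hWy : T `<=` W y by move=> z /hy[].
have hb : T `<=` opensI (cech_cover b x) (cech_cover b y).
  by move=> z Tz; split; [have [_ h] := subV x; exact/h/hVx|have [_ h] := subV y; exact/h/hVy].
rewrite (eW x y T hWx hWy hb hc) (eV x y T hVx hVy ha hb) !aresD /=.
rewrite (ares_comp _ _ hVx) (ares_comp _ _ hVy) (ares_comp _ _ hWx) (ares_comp _ _ hWy).
by rewrite -addrA opprD [in RHS]addrACA.
Qed.

Canonical cohomologous_equiv :=
  EquivRel cohomologous_rel cohomologous_refl cohomologous_sym cohomologous_trans.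

Definition cech_H1 : Type := {eq_quot cohomologous_rel}.
HB.instance Definition _ := Choice.on cech_H1.

Definition cech_class (U : pt_cover X) (c : cocycle U) : cech_H1 :=
  \pi_{eq_quot cohomologous_rel} (PreCech c).

Lemma cech_classP (U V : pt_cover X) (c : cocycle U) (d : cocycle V) :
  cech_class c = cech_class d <-> cohomologous (PreCech c) (PreCech d).
Proof. by split=> [/eqmodP/asboolP|h]; last exact/eqmodP/asboolP. Qed.

Lemma cech_elim (a : cech_H1) : exists (U : pt_cover X) (c : cocycle U), a = cech_class c.
Proof. by rewrite -[a]reprK; case: (repr _) => U c; exists U, c. Qed.

Definition zero_cover : pt_cover X := Cover (cov := fun=> Opens openT) (fun=> I).

Lemma cocycle0P (U : pt_cover X) x y z (W : opens X) (hxy : W `<=` opensI (U x) (U y))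
    (hyz : W `<=` opensI (U y) (U z)) (hxz : W `<=` opensI (U x) (U z)) :
  ares F hxy 0 + ares F hyz 0 = ares F hxz 0.
Proof. by rewrite !ares0 addr0. Qed.

Definition cocycle0 (U : pt_cover X) : cocycle U :=
  Cocycle (cocycle_fun := fun x y => 0) (@cocycle0P U).

Lemma cocycleNP (U : pt_cover X) (c : cocycle U) x y z (W : opens X)
    (hxy : W `<=` opensI (U x) (U y))
    (hyz : W `<=` opensI (U y) (U z)) (hxz : W `<=` opensI (U x) (U z)) :
  ares F hxy (- c x y) + ares F hyz (- c y z) = ares F hxz (- c x z).
Proof. by rewrite !aresN /= -opprD (cocycleP c hxy hyz hxz). Qed.

Definition cocycleN (U : pt_cover X) (c : cocycle U) : cocycle U :=
  Cocycle (cocycle_fun := fun x y => - c x y) (cocycleNP c).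

Lemma coverI_subl (U V : pt_cover X) x y :
  opensI (coverI U V x) (coverI U V y) `<=` opensI (U x) (U y).
Proof. by move=> z [[? _] [? _]]. Qed.

Lemma coverI_subr (U V : pt_cover X) x y :
  opensI (coverI U V x) (coverI U V y) `<=` opensI (V x) (V y).
Proof. by move=> z [[_ ?] [_ ?]]. Qed.

Definition cocycleD_fun (U V : pt_cover X) (c : cocycle U) (d : cocycle V) x y :
    F (opensI (coverI U V x) (coverI U V y)) :=
  ares F (@coverI_subl U V x y) (c x y) + ares F (@coverI_subr U V x y) (d x y).

Lemma cocycleDP (U V : pt_cover X) (c : cocycle U) (d : cocycle V) x y z (W : opens X)
    (hxy : W `<=` opensI (coverI U V x) (coverI U V y))
    (hyz : W `<=` opensI (coverI U V y) (coverI U V z))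
    (hxz : W `<=` opensI (coverI U V x) (coverI U V z)) :
  ares F hxy (cocycleD_fun c d x y) + ares F hyz (cocycleD_fun c d y z) =
  ares F hxz (cocycleD_fun c d x z).
Proof.
rewrite /cocycleD_fun !aresD /= addrACA.
rewrite !(ares_comp _ _ (subset_trans hxy (@coverI_subl U V x y))).
rewrite !(ares_comp _ _ (subset_trans hyz (@coverI_subl U V y z))).
rewrite !(ares_comp _ _ (subset_trans hxz (@coverI_subl U V x z))).
rewrite !(ares_comp _ _ (subset_trans hxy (@coverI_subr U V x y))).
rewrite !(ares_comp _ _ (subset_trans hyz (@coverI_subr U V y z))).
rewrite !(ares_comp _ _ (subset_trans hxz (@coverI_subr U V x z))).
congr (_ + _); exact: cocycleP.
Qed.

Definition cocycleD (U V : pt_cover X) (c : cocycle U) (d : cocycle V) :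
  cocycle (coverI U V) := Cocycle (cocycleDP c d).

Definition cech_zero : cech_H1 := cech_class (cocycle0 zero_cover).
Definition cech_add (a b : cech_H1) : cech_H1 :=
  cech_class (cocycleD (cech_cocycle (repr (a : {eq_quot cohomologous_rel})))
                       (cech_cocycle (repr (b : {eq_quot cohomologous_rel})))).
Definition cech_opp (a : cech_H1) : cech_H1 :=
  cech_class (cocycleN (cech_cocycle (repr (a : {eq_quot cohomologous_rel})))).

Lemma cech_addE (U V : pt_cover X) (c : cocycle U) (d : cocycle V) :
  cech_add (cech_class c) (cech_class d) = cech_class (cocycleD c d).
Proof.
rewrite /cech_add; case: piP => -[U' c'] /cech_classP[T [f [subT eT]]].
case: piP => -[V' d'] /cech_classP[S [g [subS eS]]] /=.
apply/esym/cech_classP; exists (coverI T S).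
exists (fun x => ares F (@opensIl _ _ _) (f x) + ares F (@opensIr _ _ _) (g x)).
split=> [x|x y W hx hy h h'] /=.
  split=> z [Tz Sz]; (have [T1 T2] := subT x; have [S1 S2] := subS x); split;
    by [exact: T1|exact: S1|exact: T2|exact: S2].
have hTx : W `<=` T x by move=> z /hx[].
have hTy : W `<=` T y by move=> z /hy[].
have hSx : W `<=` S x by move=> z /hx[].
have hSy : W `<=` S y by move=> z /hy[].
rewrite /cocycleD_fun !aresD /=.
rewrite (ares_comp _ _ hTx) (ares_comp _ _ hTy) (ares_comp _ _ hSx) (ares_comp _ _ hSy).
rewrite (ares_comp _ _ (subset_trans h (@coverI_subl U V x y))).
rewrite (ares_comp _ _ (subset_trans h (@coverI_subr U V x y))).
rewrite (ares_comp _ _ (subset_trans h' (@coverI_subl U' V' x y))).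
rewrite (ares_comp _ _ (subset_trans h' (@coverI_subr U' V' x y))).
have := eT x y W hTx hTy (subset_trans h (@coverI_subl U V x y))
  (subset_trans h' (@coverI_subl U' V' x y)); move=> /= ->.
have := eS x y W hSx hSy (subset_trans h (@coverI_subr U V x y))
  (subset_trans h' (@coverI_subr U' V' x y)); move=> /= ->.
by rewrite opprD addrACA; congr (_ + _); rewrite addrACA.
Qed.

Lemma cech_oppE (U : pt_cover X) (c : cocycle U) :
  cech_opp (cech_class c) = cech_class (cocycleN c).
Proof.
rewrite /cech_opp; case: piP => -[U' c'] /cech_classP[T [f [subT eT]]] /=.
apply/esym/cech_classP; exists T, (fun x => - f x); split=> // x y W hx hy h h' /=.
have := eT x y W hx hy h h'; rewrite /= !aresN /= => ->.
by rewrite !opprD opprK.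
Qed.

(* Classes are equal as soon as their representatives agree on overlaps. *)
Lemma cech_class_eq (U V : pt_cover X) (c : cocycle U) (d : cocycle V) :
  (forall x y (W : opens X) (h : W `<=` opensI (U x) (U y))
    (k : W `<=` opensI (V x) (V y)), ares F h (c x y) = ares F k (d x y)) ->
  cech_class c = cech_class d.
Proof.
move=> e; apply/cech_classP; exists (coverI U V), (fun=> 0).
split=> [x|x y T hx hy h k] /=; first by split; [exact: opensIl|exact: opensIr].
by rewrite !ares0 subrr addr0; apply/esym/e.
Qed.

Lemma cech_addC : commutative cech_add.
Proof.
move=> a b; have [U [c ->]] := cech_elim a; have [V [d ->]] := cech_elim b.
rewrite !cech_addE; apply: cech_class_eq => x y W h k /=.
rewrite /cocycleD_fun !aresD /= addrC.
rewrite !(ares_comp _ _ (subset_trans h (@coverI_subl U V x y))).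
by rewrite !(ares_comp _ _ (subset_trans h (@coverI_subr U V x y))).
Qed.

Lemma cech_addA : associative cech_add.
Proof.
move=> a b e; have [U [c ->]] := cech_elim a; have [V [d ->]] := cech_elim b.
have [T [f ->]] := cech_elim e.
rewrite !cech_addE; apply: cech_class_eq => x y W h k /=.
rewrite /cocycleD_fun !aresD /=.
have hU : W `<=` opensI (U x) (U y) by move=> z /h[[? _] [? _]].
have hV : W `<=` opensI (V x) (V y) by move=> z /h[[_ [? _]] [_ [? _]]].
have hT : W `<=` opensI (T x) (T y) by move=> z /h[[_ [_ ?]] [_ [_ ?]]].
have hVT := subset_trans h (@coverI_subr U (coverI V T) x y).
have hUV := subset_trans k (@coverI_subl (coverI U V) T x y).
rewrite !(ares_comp _ _ hVT) !(ares_comp _ _ hUV).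
by rewrite !(ares_comp _ _ hU) !(ares_comp _ _ hV) !(ares_comp _ _ hT) addrA.
Qed.

Lemma cech_add0 : left_id cech_zero cech_add.
Proof.
move=> a; have [U [c ->]] := cech_elim a; rewrite cech_addE.
apply: cech_class_eq => x y W h k /=.
by rewrite /cocycleD_fun !aresD /= !ares0 add0r (ares_comp _ _ k).
Qed.

Lemma cech_addN : left_inverse cech_zero cech_opp cech_add.
Proof.
move=> a; have [U [c ->]] := cech_elim a; rewrite cech_oppE cech_addE.
apply: cech_class_eq => x y W h k /=.
rewrite /cocycleD_fun !aresD /= !aresN /=.
have hU : W `<=` opensI (U x) (U y) by move=> z /h[[? _] [? _]].
by rewrite !(ares_comp _ _ hU) addNr ares0.
Qed.

HB.instance Definition _ :=
  GRing.isZmodule.Build cech_H1 cech_addA cech_addC cech_add0 cech_addN.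

End Cech.

Section MetricGraph.
Variables (R : realType) (X : metricType R).

(* [psi] identifies the star with [n] rays of length [r] isometrically with the
   open ball of radius [r] around [x]; [psi i t] is the point at distance [t]
   from the centre on the ray [i]. *)
Definition is_star (x : X) (n : nat) (r : R) (psi : 'I_n -> R -> X) : Prop :=
  [/\ 0 < r,
      forall i, psi i 0 = x,
      forall i j s t, 0 <= s < r -> 0 <= t < r ->
        mdist (psi i s) (psi j t) = if i == j then `|s - t| else s + t
    & forall y, mdist x y < r -> y = x \/ exists i t, 0 <= t < r /\ y = psi i t].

Definition metric_graph : Prop :=
  forall x, exists n r (psi : 'I_n -> R -> X), is_star x r psi.

(* Near [x], [f] is linear with integer slopes on the rays emanating from [x],
   and the outgoing slopes sum to zero. Continuity at [x] follows. *)
Definition harmonic_at (f : X -> R) (x : X) : Prop :=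
  forall n r (psi : 'I_n -> R -> X), is_star x r psi ->
  exists k : 'I_n -> int, \sum_i k i = 0 /\
  exists e, 0 < e <= r /\
    forall i t, 0 <= t < e -> f (psi i t) = f x + (k i)%:~R * t.

(* A section over [U] is encoded by its extension by zero to the whole space. *)
Definition harmonic_on (U : opens X) : {pred X -> R} :=
  fun f => `[< (forall x, ~ U x -> f x = 0) /\ forall x, U x -> harmonic_at f x >].

Lemma harmonic_on_closed (U : opens X) : zmod_closed (harmonic_on U).
Proof.
split=> [|f g /asboolP[f0 hf] /asboolP[g0 hg]]; apply/asboolP; split=> // x Ux.
- move=> n r psi [r0 _ _ _]; exists (fun=> 0); split; first by rewrite big1.
  exists r; rewrite r0 lexx; split=> // i t _.
  by rewrite mul0r addr0.
- by rewrite /= -[LHS]/(f x - g x) f0 // g0 // subr0.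
move=> n r psi st; have [k [k0 [e [/andP[e0 er] he]]]] := hf x Ux n r psi st.
have [l [l0 [d [/andP[d0 dr] hd]]]] := hg x Ux n r psi st.
exists (fun i => k i - l i); split; first by rewrite sumrB k0 l0 subr0.
exists (Num.min e d); rewrite lt_min e0 d0 ge_min er; split=> // i t /andP[t0].
rewrite lt_min => /andP[te td].
rewrite -[LHS]/(f (psi i t) - g (psi i t)) -[(f - g) x]/(f x - g x).
by rewrite he ?t0 // hd ?t0 // rmorphB mulrBl opprD addrACA.
Qed.

HB.instance Definition _ (U : opens X) :=
  GRing.isZmodClosed.Build (X -> R) (harmonic_on U) (harmonic_on_closed U).

Record harmonic_section (U : opens X) := Harmonic {
  harmonic_fun :> X -> R;
  harmonicP : harmonic_fun \in harmonic_on U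
}.

HB.instance Definition _ U := [isSub for @harmonic_fun U].
HB.instance Definition _ U := [Choice of harmonic_section U by <:].
HB.instance Definition _ U := [SubChoice_isSubZmodule of harmonic_section U by <:].

Lemma harmonic_ext (U : opens X) (f g : harmonic_section U) : (forall x, U x -> f x = g x) -> f = g.
Proof.
move=> fg; apply/val_inj/funext => x; case: (pselect (U x)) => [/fg //|nUx].
have /asboolP[f0 _] := harmonicP f; have /asboolP[g0 _] := harmonicP g.
by rewrite /= f0 // g0.
Qed.

Lemma harmonic_res_subproof (U V : opens X) (h : V `<=` U) (f : harmonic_section U) :
  patch (fun=> 0) V f \in harmonic_on V.
Proof.
apply/asboolP; split=> x Vx; first by rewrite patchC // inE.
move=> n r psi st; have /asboolP[_ /(_ x (h x Vx) n r psi st)] := harmonicP f.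
case=> k [k0 [e [/andP[e0 er] he]]]; exists k; split=> //.
have /nbhs_ballP[d /= d0 dV] : nbhs x V by apply: open_nbhs_nbhs; split=> //; exact: oopen.
exists (Num.min e d); rewrite lt_min e0 d0 ge_min er; split=> // i t /andP[t0].
rewrite lt_min => /andP[te td]; case: (st) => r0 c iso _.
have Vt : V (psi i t).
  apply: dV; rewrite ballEmdist /= -(c i) iso ?lexx ?r0 ?t0 ?(lt_le_trans te) // eqxx.
  by rewrite sub0r normrN ger0_norm.
by rewrite !patchT ?inE // he // t0.
Qed.

Definition harmonic_res (U V : opens X) (h : V `<=` U) (f : harmonic_section U) : harmonic_section V :=
  Harmonic (harmonic_res_subproof h f).

Lemma harmonic_res_zmod_morphism (U V : opens X) (h : V `<=` U) :
  zmod_morphism (harmonic_res h).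
Proof.
move=> f g; apply: harmonic_ext => x Vx; rewrite [RHS]/= -[RHS]/(_ - _) /=.
by rewrite !patchT ?inE.
Qed.

HB.instance Definition _ (U V : opens X) (h : V `<=` U) :=
  GRing.isZmodMorphism.Build (harmonic_section U) (harmonic_section V) (harmonic_res h)
    (harmonic_res_zmod_morphism h).

Lemma harmonic_res_id (U : opens X) (h : U `<=` U) (f : harmonic_section U) :
  harmonic_res h f = f.
Proof. by apply: harmonic_ext => x Ux; rewrite /= patchT ?inE. Qed.

Lemma harmonic_res_comp (U V W : opens X) (h : V `<=` U) (k : W `<=` V) (l : W `<=` U)
    (f : harmonic_section U) : harmonic_res k (harmonic_res h f) = harmonic_res l f.
Proof.
by apply: harmonic_ext => x Wx; rewrite /= !patchT ?inE //; exact: k.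
Qed.

Definition harmonic_sheaf : abpresheaf X :=
  @AbPresheaf X (fun U => harmonic_section U) (fun U V h => harmonic_res h)
    harmonic_res_id harmonic_res_comp.

(* H^1 with coefficients in the harmonic functions; Čech and sheaf cohomology
   agree in degree one. *)
Definition Pic : zmodType := cech_H1 harmonic_sheaf.

End MetricGraph.

Section Bundles.
Variables (R : realType) (X : metricType R) (Phi : root_datum).

Notation W := (weyl Phi).
Notation H := (harmonic_sheaf X).

(* [Mc ⊗ H] and the constant sheaf [W] are the sheafifications of the presheaves
   [U |-> Mc ⊗ H U] and [U |-> W], so their semidirect product is the
   sheafification of [U |-> (Mc ⊗ H U) ⋊ W]. *)

Definition G_res (U V : opens X) (h : V `<=` U) (g : semidirect Phi (H U)) :
    semidirect Phi (H V) :=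
  (tensor_map idfun (ares H h) g.1, g.2).

Lemma G_resM (U V : opens X) (h : V `<=` U) : {morph G_res h : s t / (s * t)%g}.
Proof.
move=> s t; congr (_, _); rewrite /= raddfD /=; congr (_ + _).
rewrite /weyl_actl (tensor_map_comp (h := s.2) (k := ares H h)) //.
by rewrite (tensor_map_comp (h := s.2) (k := ares H h)).
Qed.

Lemma G_res_id (U : opens X) (h : U `<=` U) (s : semidirect Phi (H U)) : G_res h s = s.
Proof.
case: s => t w; congr (_, _); rewrite /= -[RHS]tensor_map_id.
elim/tensor_ind: t => [|x y hx hy|a f]; first by rewrite !tensor_map0.
  by rewrite !tensor_mapB hx hy.
by rewrite !tensor_mapE /= harmonic_res_id.
Qed.

Lemma G_res_comp (U V V' : opens X) (h : V `<=` U) (k : V' `<=` V) (l : V' `<=` U)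
    (s : semidirect Phi (H U)) : G_res k (G_res h s) = G_res l s.
Proof.
congr (_, _); rewrite /= (tensor_map_comp (h := idfun) (k := ares H l)) // => f.
exact: (ares_comp h k l).
Qed.

Definition G_presheaf : gpresheaf X :=
  @GPresheaf X (fun U => semidirect Phi (H U)) G_res G_resM G_res_id G_res_comp.

Definition G_sheaf : gpresheaf X := gsheafify G_presheaf.

Definition W_sheaf : gpresheaf X := gsheafify (const_gpresheaf X W).

Definition G_to_W : ghom G_sheaf W_sheaf :=
  gsheafify_hom
    (@GHom X G_presheaf (const_gpresheaf X W) (fun U g => g.2)
      (fun U s t => erefl) (fun U V h s => erefl)).

Definition G_incl (U : opens X) (t : tensor (rd_Mc Phi) (H U)) : G_sheaf U :=
  gsh_unit ((t, 1%g) : G_presheaf U).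

Definition G_bundle := torsor G_sheaf.

Definition assoc_W (E : G_bundle) : gspace W_sheaf := push G_to_W E.

Definition iso_classes (T : Type) (r : T -> T -> Prop) : Type :=
  {C : T -> Prop | exists x, C = r x}.

Definition iso_class (T : Type) (r : T -> T -> Prop) (x : T) : iso_classes r :=
  exist _ (r x) (ex_intro _ x erefl).

Record marked_bundle (tau : torsor W_sheaf) := MarkedBundle {
  mb_bundle : G_bundle;
  mb_iso : giso (assoc_W mb_bundle) tau
}.

Definition marked_iso (tau : torsor W_sheaf) (E F : marked_bundle tau) : Prop :=
  exists f : giso (mb_bundle E) (mb_bundle F),
    forall (U : opens X) (s : assoc_W (mb_bundle E) U),
      mb_iso F U (push_map G_to_W f U s) = mb_iso E U s.

Definition Mtilde (tau : torsor W_sheaf) : Type := iso_classes (@marked_iso tau).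

Definition marked_class (tau : torsor W_sheaf) (E : marked_bundle tau) : Mtilde tau :=
  iso_class (@marked_iso tau) E.

Definition bundle_of_type (tau : torsor W_sheaf) : Type :=
  {E : G_bundle | inhabited (giso (assoc_W E) tau)}.

Definition bundle_iso (tau : torsor W_sheaf) (E F : bundle_of_type tau) : Prop :=
  inhabited (giso (sval E) (sval F)).

Definition Mbundle (tau : torsor W_sheaf) : Type := iso_classes (@bundle_iso tau).

Definition bundle_class (tau : torsor W_sheaf) (E : G_bundle)
    (phi : giso (assoc_W E) tau) : Mbundle tau :=
  iso_class (@bundle_iso tau) (exist _ E (inhabits phi)).

Definition W_orbit_rel (t t' : tensor (Pic X) (rd_Mc Phi)) : Prop :=
  exists w : W, t' = weyl_actr w t.

Definition W_orbits : Type := iso_classes W_orbit_rel.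

Definition W_orbit (t : tensor (Pic X) (rd_Mc Phi)) : W_orbits :=
  iso_class W_orbit_rel t.

Definition trivial_W : torsor W_sheaf := trivial_torsor (const_gpresheaf X W).

(* [E] is glued over the cover [U] by the transition functions
   [\sum_i m i ⊗ c i], in local trivializations sent to 1 by the marking. After
   refining [U], every marked bundle admits such a description. *)
Definition has_transition (E : marked_bundle trivial_W) (U : pt_cover X) (n : nat)
    (c : 'I_n -> cocycle H U) (m : 'I_n -> rd_Mc Phi) : Prop :=
  exists e : forall x, mb_bundle E (U x),
    (forall x, mb_iso E (U x) (push_section G_to_W (e x)) = 1%g :> W_sheaf (U x)) /\
    forall x y,
      pres (@opensIr X (U x) (U y)) (e y) =
      gact (pres (@opensIl X (U x) (U y)) (e x)) (G_incl (\sum_i tens (m i) (c i x y))).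

End Bundles.

(* Main.v *)
(* Choose a basis b_k of Mc, so that Mc ⊗ A is a finite power of A for every
   abelian group A; in particular Mc ⊗ H is already a sheaf, and it is the kernel
   of G_Gam -> W_Gam. A marked bundle therefore has local sections sent to 1 by
   the marking, with transition functions sum_k b_k ⊗ C_k for cocycles C_k in H.
   Two such systems of sections differ by sections of Mc ⊗ H, so the classes
   [C_k] in Pic are well defined and, by gluing, classify the marked bundle up to
   isomorphism; conversely every family of cocycles glues to a bundle. Since Gam
   is connected, two markings of one bundle differ by a constant w in W, and
   replacing the sections e_x by e_x w^-1 acts on the transition functions by w. *)
From HB Require Import structures.
Require Import Defs.
From mathcomp Require Import all_boot all_order all_algebra.
From mathcomp Require Import boolp classical_sets functions reals topology.

Set Implicit Arguments.
Unset Strict Implicit.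
Unset Printing Implicit Defensive.

Import Order.TTheory GRing.Theory Num.Theory VectorInternalTheory.
Local Open Scope classical_set_scope.
Local Open Scope ring_scope.

(** * Sheaves and torsors *)

(** Sections of [G_Gam], of [W_Gam] and of the contracted product are given by pairs or classes only
    locally, because all three are sheafifications. Existence over an open set is therefore reduced
    to local existence of something unique, and uniqueness itself supplies the agreement on
    overlaps; this is why freeness or injectivity precedes existence throughout. That [Mc ⊗ H] is a
    sheaf makes every section killed by the projection to [W_Gam] a genuine tensor over its whole
    domain, so transition functions can be read coordinate by coordinate. Each coordinate brings its
    own cover and cochain, and finite rank allows one common refinement. The inverse in [e_x w^-1]
    comes from the right action: if [e_y = e_x t], then [e_y w^-1 = (e_x w^-1)(w t w^-1)], and
    conjugation by [w] in the semidirect product is the action of [w] on [Mc]. *)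

Section Sheaf.
Variables (X : topologicalType) (F : presheaf X).
Hypothesis shF : is_sheaf F.

Lemma sheaf_sep (U : opens X) (s t : F U) :
  (forall x, U x -> exists (V : opens X) (h : V `<=` U), V x /\ pres h s = pres h t) ->
  s = t.
Proof.
move=> loc; pose I := {x | U x}.
have ch (i : I) : {V : opens X | exists h : V `<=` U, V (sval i) /\ pres h s = pres h t}.
  by apply: cid; apply: loc; exact: svalP.
pose V i := sval (ch i).
have hV i : V i `<=` U by case: (svalP (ch i)).
have e i : pres (hV i) s = pres (hV i) t.
  case: (svalP (ch i)) => h [_]; by rewrite (Prop_irrelevance h (hV i)).
have cov : U `<=` \bigcup_i V i.
  move=> x Ux; exists (exist _ x Ux) => //.
  by case: (svalP (ch (exist _ x Ux))) => h [].
have [|u [_ uniq]] := shF hV cov (s := fun i => pres (hV i) t).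
  move=> i j; have h : opensI (V i) (V j) `<=` U by move=> z [/hV].
  by rewrite !(pres_comp _ _ h).
by rewrite -(uniq s e) -(uniq t).
Qed.

(** Uniqueness together with stability under restriction forces chosen local solutions to agree on
    overlaps. As [P] need not be a local property, the conclusion stays local and each use descends
    to [U] by [sheaf_sep]. *)
Lemma sheaf_local (U : opens X) (P : forall V : opens X, V `<=` U -> F V -> Prop) :
  (forall (V : opens X) (h : V `<=` U) s t, P V h s -> P V h t -> s = t) ->
  (forall (V T : opens X) (h : V `<=` U) (k : T `<=` V) (l : T `<=` U) s,
    P V h s -> P T l (pres k s)) ->
  (forall x, U x -> exists (V : opens X) (h : V `<=` U) s, V x /\ P V h s) ->
  exists t : F U, forall x, U x ->
    exists (V : opens X) (h : V `<=` U), V x /\ P V h (pres h t).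
Proof.
move=> uniq res loc; pose I := {x | U x}.
have ch (i : I) : {V : opens X | exists (h : V `<=` U) s, V (sval i) /\ P V h s}.
  by apply: cid; apply: loc; exact: svalP.
pose V i := sval (ch i).
have hV i : V i `<=` U by case: (svalP (ch i)).
have ch' i : {s | V i (sval i) /\ P (V i) (hV i) s}.
  apply: cid; case: (svalP (ch i)) => h [s].
  by rewrite (Prop_irrelevance h (hV i)); exists s.
have cov : U `<=` \bigcup_i V i.
  by move=> x Ux; exists (exist _ x Ux) => //; case: (svalP (ch' (exist _ x Ux))).
have [|u [eu _]] := shF hV cov (s := fun i => sval (ch' i)).
  move=> i j; have h : opensI (V i) (V j) `<=` U by move=> z [/hV].
  by apply: (uniq _ h); apply: res; exact: (svalP (ch' _)).2.
exists u => x Ux; exists (V (exist _ x Ux)), (hV _); split.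
  exact: (svalP (ch' (exist _ x Ux))).1.
by rewrite eu; exact: (svalP (ch' (exist _ x Ux))).2.
Qed.

End Sheaf.

Lemma gres_irr (X : topologicalType) (G : gpresheaf X) (U V : opens X) (h k : V `<=` U)
  (s : G U) : gres h s = gres k s.
Proof. by rewrite (Prop_irrelevance h k). Qed.

Section Torsors.
Variables (X : topologicalType) (G : gpresheaf X).

Lemma torsor_sheaf (P : torsor G) : is_sheaf P.
Proof. by case: (torsorP P). Qed.

Lemma torsor_trans (P : torsor G) (U : opens X) (s t : P U) :
  exists g, gact s g = t.
Proof. by case: (torsorP P) => _ _ /(_ U s t)[g [e _]]; exists g. Qed.

Lemma torsor_free (P : torsor G) (U : opens X) (s : P U) (g h : G U) :
  gact s g = gact s h -> g = h.
Proof.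
case: (torsorP P) => _ _ /(_ U s (gact s h))[k [_ u]] e.
by rewrite -(u g e) -(u h).
Qed.

Lemma torsor_section (P : torsor G) x : exists (U : opens X) (s : P U), U x.
Proof. by case: (torsorP P) => _ /(_ x)[U [Ux [s]]] _; exists U, s. Qed.

(** Freeness of the action on the target gives injectivity over every open set. Locally a section of
    [Q] is a translate of the image of a section of [P], and the preimages, being unique, glue. *)
Lemma torsor_map_bij (P Q : torsor G) (f : gmap P Q) (U : opens X) : bijective (f U).
Proof.
have inj V : injective (f V).
  move=> s t; have [g <-] := torsor_trans s t.
  by rewrite gmap_act -{1}[f V s]gact1 => /torsor_free <-; rewrite gact1.
suff surj t : exists s, f U s = t.
  exists (fun t => sval (cid (surj t))) => [s|t]; last by case: cid.
  by apply: inj; case: cid.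
have [||x Ux|s es] := @sheaf_local _ _ (torsor_sheaf (P := P)) U
    (fun V h s => f V s = pres h t).
- by move=> V h s s' <- /inj.
- by move=> V T h k l s es; rewrite gmap_res es (pres_comp _ _ l).
- have [V [s Vx]] := torsor_section P x.
  have [g eg] := torsor_trans (f _ (pres (@opensIl _ V U) s)) (pres (@opensIr _ V U) t).
  exists (opensI V U), (@opensIr _ V U), (gact (pres (@opensIl _ V U) s) g).
  by split=> //; rewrite gmap_act.
exists s; apply: (sheaf_sep (torsor_sheaf (P := Q))) => x Ux.
have [V [h [Vx e]]] := es x Ux; exists V, h; split=> //.
by rewrite -gmap_res.
Qed.

Definition torsor_iso (P Q : torsor G) (f : gmap P Q) : giso P Q :=
  GIso (torsor_map_bij f).

Lemma gmap_eq (P : torsor G) (Q : gspace G) (f g : gmap P Q) : is_sheaf Q ->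
  (forall x, exists (U : opens X) (s : P U), U x /\ f U s = g U s) ->
  forall (U : opens X) (s : P U), f U s = g U s.
Proof.
move=> shQ loc U s; apply: (sheaf_sep shQ) => x Ux.
have [V [t [Vx e]]] := loc x.
exists (opensI V U), (@opensIr _ V U); split=> //; rewrite -!gmap_res.
have [a <-] := torsor_trans (pres (@opensIl _ V U) t) (pres (@opensIr _ V U) s).
by rewrite !gmap_act !gmap_res e.
Qed.

Lemma gact_inv (P : gspace G) (U : opens X) (s : P U) g :
  gact (gact s g) g^-1%g = s.
Proof. by rewrite -gactM mulgV gact1. Qed.

(** Quantifying over all [T] and all inclusions avoids reconciling different composites of
    restrictions; [transitionP] reduces it to the overlaps. *)
Definition transition (P : gspace G) (U : pt_cover X) (e : forall x, P (U x))
    (g : forall x y, G (opensI (U x) (U y))) : Prop :=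
  forall x y (T : opens X) (hx : T `<=` U x) (hy : T `<=` U y)
    (hxy : T `<=` opensI (U x) (U y)),
    pres hy (e y) = gact (pres hx (e x)) (gres hxy (g x y)).

Lemma transitionP (P : gspace G) (U : pt_cover X) (e : forall x, P (U x))
    (g : forall x y, G (opensI (U x) (U y))) :
  (forall x y, pres (@opensIr X (U x) (U y)) (e y) =
     gact (pres (@opensIl X (U x) (U y)) (e x)) (g x y)) <-> transition e g.
Proof.
split=> [eg x y T hx hy hxy|eg x y]; last first.
  by rewrite (eg x y _ (@opensIl _ _ _) (@opensIr _ _ _) (@subset_refl _ _)) gres_id.
by rewrite -(pres_comp (@opensIr _ _ _) hxy hy) eg gact_res (pres_comp _ _ hx).
Qed.

Lemma opens_inP (U V T : opens X) : T `<=` U -> T `<=` V -> T `<=` opensI U V.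
Proof. by move=> h k x Tx; split; [exact: h|exact: k]. Qed.

(** Over [U x] the equivariant map is forced to be [e x * a |-> f x * a]; equal transition functions
    make these maps agree on overlaps. *)
Lemma glue_map (P Q : torsor G) (U : pt_cover X) (e : forall x, P (U x))
    (f : forall x, Q (U x)) (g : forall x y, G (opensI (U x) (U y))) :
  transition e g -> transition f g ->
  exists h : gmap P Q, forall x, h (U x) (e x) = f x.
Proof.
move=> eg fg.
(* The graph of the map sought: [s] and [t] have the same coordinate relative to [e x] and [f x],
   wherever it is defined. *)
pose rel (V : opens X) (s : P V) (t : Q V) := forall x (T : opens X) (hT : T `<=` V)
  (hx : T `<=` U x) (a : G T), pres hT s = gact (pres hx (e x)) a ->
  pres hT t = gact (pres hx (f x)) a.
(* One index [x] suffices: passing to [y] multiplies both coordinates by the same transition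
   function. *)
have relT (V : opens X) (s : P V) (t : Q V) x (hx : V `<=` U x) (a : G V) :
    s = gact (pres hx (e x)) a -> t = gact (pres hx (f x)) a -> rel V s t.
  move=> es et y T hT hy b; rewrite es et !gact_res !(pres_comp _ _ (subset_trans hT hx)).
  have hxy := opens_inP (subset_trans hT hx) hy.
  rewrite (eg x y T (subset_trans hT hx) hy hxy) (fg x y T (subset_trans hT hx) hy hxy).
  by rewrite -!gactM => /torsor_free ->.
have rel_uniq (V : opens X) (s : P V) (t t' : Q V) : rel V s t -> rel V s t' -> t = t'.
  move=> r r'; apply: (sheaf_sep (torsor_sheaf (P := Q))) => x Vx.
  exists (opensI V (U x)), (@opensIl _ _ _); split; first by split=> //; exact: covP.
  have [a ea] := torsor_trans (pres (@opensIr _ V (U x)) (e x)) (pres (@opensIl _ V (U x)) s).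
  by rewrite (r _ _ _ _ a (esym ea)) (r' _ _ _ _ a (esym ea)).
have rel_res (V V' : opens X) (k : V' `<=` V) (s : P V) (t : Q V) :
    rel V s t -> rel V' (pres k s) (pres k t).
  move=> r x T hT hx a; rewrite !(pres_comp _ _ (subset_trans hT k)) => e'.
  exact: (r x).
have rel_ex (V : opens X) (s : P V) : exists t, rel V s t.
  have [||x Vx|t et] := @sheaf_local _ _ (torsor_sheaf (P := Q)) V
    (fun V' h t => rel V' (pres h s) t).
  - by move=> V' h t t'; exact: rel_uniq.
  - by move=> V' T h k l t /(rel_res _ _ k); rewrite (pres_comp _ _ l).
  - have [a ea] := torsor_trans (pres (@opensIr _ V (U x)) (e x))
      (pres (@opensIl _ V (U x)) s).
    exists (opensI V (U x)), (@opensIl _ _ _), (gact (pres (@opensIr _ V (U x)) (f x)) a).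
    by split; [split=> //; exact: covP|exact: relT (esym ea) erefl].
  exists t => x T hT hx a es; apply: (sheaf_sep (torsor_sheaf (P := Q))) => y Ty.
  have [V' [h [V'y r]]] := et y (hT y Ty).
  exists (opensI V' T), (@opensIr _ _ _); split=> //.
  have k := subset_trans (@opensIr _ V' T) hx.
  have l := subset_trans (@opensIr _ V' T) hT.
  have := r x (opensI V' T) (@opensIl _ _ _) k (gres (@opensIr _ _ _) a).
  rewrite gact_res !(pres_comp _ _ l) (pres_comp _ _ k) => -> //.
  by rewrite -(pres_comp hT (@opensIr _ V' T) l) es gact_res (pres_comp _ _ k).
pose h (V : opens X) (s : P V) := sval (cid (rel_ex V s)).
have hP V s : rel V s (h V s) by exact: svalP.
have h_res (V V' : opens X) (k : V' `<=` V) (s : P V) : h V' (pres k s) = pres k (h V s).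
  by apply: rel_uniq (hP _ _) _; exact/rel_res/hP.
have h_act (V : opens X) (s : P V) (a : G V) : h V (gact s a) = gact (h V s) a.
  apply: rel_uniq (hP _ _) _ => x T hT hx b; rewrite !gact_res => es.
  rewrite (hP V s x T hT hx (b * (gres hT a)^-1)%g) ?gactM.
    by rewrite -gactM mulVg gact1.
  by rewrite -es gact_inv.
exists (GMap h_res h_act) => x /=; apply: rel_uniq (hP _ _) _.
by apply: (relT _ _ _ x (@subset_refl _ _) 1%g); rewrite gact1 pres_id.
Qed.

End Torsors.

(** * Contracted products of torsors *)

Section PushTorsor.
Variables (X : topologicalType) (G K : gpresheaf X) (pi : ghom G K).
Hypothesis shK : is_sheaf (gpre K).

Lemma ghom1 (U : opens X) : pi U 1%g = 1%g.
Proof. by apply: (mulgI (pi U 1%g)); rewrite -ghomM !mulg1. Qed.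

Lemma push_section_act1 (P : gspace G) (U : opens X) (p : P U) (k : K U) :
  gact (push_section pi p) k = @sh_unit X (push_presheaf pi P) U (push_class pi p k).
Proof.
apply: shsec_ext => x Ux /=.
rewrite (germ_actE _ _ _ _ Ux (@subset_refl _ _) (@subset_refl _ _)).
by rewrite pres_id gres_id /= push_actE mul1g.
Qed.

Lemma push_section_act (P : gspace G) (U : opens X) (p : P U) (g : G U) :
  push_section pi (gact p g) = gact (push_section pi p) (pi U g).
Proof.
rewrite push_section_act1 /push_section; congr sh_unit.
by apply/esym/push_classP; exists g; rewrite mulVg.
Qed.

Lemma push_section_res (P : gspace G) (U V : opens X) (h : V `<=` U) (p : P U) :
  push_section pi (pres h p) = pres h (push_section pi p).
Proof.
apply: shsec_ext => x Vx /=.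
rewrite -(@germ_of_res X (push_presheaf pi P) x U V h (h x Vx) Vx).
by congr germ_of; rewrite /= push_resE gres1.
Qed.

Lemma push_is_sheaf (P : gspace G) : is_sheaf (push pi P).
Proof. exact: sheafify_is_sheaf. Qed.

Variable P : torsor G.

(** Locally, equality of the classes of [(p, k)] and [(p, l)] gives a [g] fixing [p] and carrying
    [k] to [l]; freeness on [P] forces [g = 1]. *)
Lemma push_section_free (U : opens X) (p : P U) (k l : K U) :
  gact (push_section pi p) k = gact (push_section pi p) l -> k = l.
Proof.
rewrite !push_section_act1 => e; apply: (sheaf_sep shK) => x Ux.
have := congr1 (fun s : shsec (push_presheaf pi P) U => s x Ux) e.
move=> /germ_ofP[V [h [h' [Vx]]]]; rewrite (Prop_irrelevance h' h) /= !push_resE.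
move=> /push_classP[g []]; rewrite -{1}[pres h p]gact1 => /torsor_free <- ekl.
by exists V, h; split=> //=; rewrite ekl ghom1 invg1 mul1g.
Qed.

(** A local class of [(p', k')] with [p' = p g] is also the class of [(p, pi(g) k')]; these second
    components are unique and glue. *)
Lemma push_section_gen (U : opens X) (p : P U) (s : push pi P U) :
  exists k, s = gact (push_section pi p) k.
Proof.
have [||x Ux|k ek] := @sheaf_local _ _ shK U
  (fun V h k => pres h s = gact (push_section pi (pres h p)) k).
- by move=> V h k l -> /push_section_free.
- move=> V T h k l a e.
  by rewrite -(pres_comp h k l) e (gact_res k) -push_section_res (pres_comp _ _ l).
- have [V [hV [t [Vx et]]]] := sh_loc s Ux.
  have [p' [k' e']] := push_quot_elim t.
  have [g eg] := torsor_trans (pres hV p) p'.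
  exists V, hV, (pi V g * k')%g; split=> //; rewrite push_section_act1.
  apply: shsec_ext => y Vy /=; rewrite et e' -eg; congr germ_of.
  by apply/esym/push_classP; exists g; rewrite mulKg.
exists k; apply: (sheaf_sep (@push_is_sheaf P)) => x Ux.
have [V [h [Vx e]]] := ek x Ux; exists V, h; split=> //.
by rewrite e push_section_res (gact_res h).
Qed.

Lemma push_is_torsor : is_torsor (push pi P).
Proof.
have free U (s : push pi P U) k l : gact s k = gact s l -> k = l.
  move=> e; apply: (sheaf_sep shK) => x Ux.
  have [V [p Vx]] := torsor_section P x.
  exists (opensI U V), (@opensIl _ _ _); split=> //.
  have [m em] := push_section_gen (pres (@opensIr _ U V) p) (pres (@opensIl _ U V) s).
  have := congr1 (pres (@opensIl _ U V)) e; rewrite !gact_res em -!gactM.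
  by move/push_section_free/mulgI.
split=> [|x|U s t]; first exact: sheafify_is_sheaf.
  have [V [p Vx]] := torsor_section P x.
  by exists V; split=> //; exact: (inhabits (push_section pi p)).
have [||x Ux|k ek] := @sheaf_local _ _ shK U (fun V h k => gact (pres h s) k = pres h t).
- by move=> V h k l <- /free.
- by move=> V T h k l a e; rewrite -(pres_comp h k l) -(pres_comp h k l) -e (gact_res k).
- have [V [p Vx]] := torsor_section P x.
  exists (opensI U V), (@opensIl _ _ _).
  have [k ek] := push_section_gen (pres (@opensIr _ U V) p) (pres (@opensIl _ U V) s).
  have [l el] := push_section_gen (pres (@opensIr _ U V) p) (pres (@opensIl _ U V) t).
  by exists (k^-1 * l)%g; split=> //; rewrite ek el -gactM mulVKg.
exists k; split=> [|l el]; last first.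
  apply: (sheaf_sep shK) => x Ux; have [V [h [Vx e]]] := ek x Ux; exists V, h; split=> //.
  by apply: free (pres h s) _ _ _; rewrite e -el (gact_res h).
apply: (sheaf_sep (@push_is_sheaf P)) => x Ux.
by have [V [h [Vx e]]] := ek x Ux; exists V, h; rewrite -e (gact_res h).
Qed.

Definition push_torsor : torsor K := Torsor push_is_torsor.

End PushTorsor.

(** The pushed sections have transition functions [pi(g) = 1], as do the unit sections of the
    trivial torsor, so [glue_map] applies. *)
Lemma marking_exists (X : topologicalType) (G K : gpresheaf X) (pi : ghom G (gsheafify K))
    (P : torsor G) (U : pt_cover X) (e : forall x, P (U x))
    (g : forall x y, G (opensI (U x) (U y))) :
  transition e g -> (forall x y, pi _ (g x y) = 1%g) ->
  exists phi : giso (push pi P) (trivial_torsor K),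
    forall x, phi (U x) (push_section pi (e x)) = 1%g.
Proof.
move=> eg pig; have shK : is_sheaf (gpre (gsheafify K)) by exact: sheafify_is_sheaf.
have [||h eh] := @glue_map _ _ (push_torsor pi shK P) (trivial_torsor K) U
    (fun x => push_section pi (e x)) (fun x => 1%g) (fun _ _ => 1%g).
- move=> x y T hx hy hxy; rewrite gres1 gact1 -!push_section_res (eg x y T hx hy hxy).
  by rewrite push_section_act ghom_res pig gres1 gact1.
- move=> x y T hx hy hxy; rewrite gres1 gact1.
  by transitivity (1%g : gsheafify K T); [|apply/esym]; exact: (gres1 (gsheafify K)).
by exists (torsor_iso h) => x; rewrite /= eh.
Qed.

Lemma opensI_subl (X : topologicalType) (V V' T : opens X) :
  V' `<=` V -> opensI V' T `<=` opensI V T.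
Proof. by move=> h x [/h]. Qed.

Arguments opensI_subl {X V V'} T h _ _.

(** * Torsors glued from a cocycle *)

Section CocycleTorsor.
Variables (X : topologicalType) (G : gpresheaf X).
Hypothesis shG : is_sheaf (gpre G).
Variables (U : pt_cover X) (g : forall x y, G (opensI (U x) (U y))).
Hypothesis g_cocycle : forall x y z (T : opens X) (hxy : T `<=` opensI (U x) (U y))
  (hyz : T `<=` opensI (U y) (U z)) (hxz : T `<=` opensI (U x) (U z)),
  (gres hxy (g x y) * gres hyz (g y z) = gres hxz (g x z))%g.

(** A section is encoded by its coordinates [s_x] relative to the local sections [e_x] to be
    constructed: [e_x s_x = e_y s_y] and [e_y = e_x g_xy] give [s_x = g_xy s_y]. *)
Record cocycle_sec (V : opens X) := CocycleSec {
  csec_fun :> forall x, G (opensI V (U x));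
  csecP : forall x y (T : opens X) (hx : T `<=` opensI V (U x)) (hy : T `<=` opensI V (U y))
    (hxy : T `<=` opensI (U x) (U y)),
    gres hx (csec_fun x) = (gres hxy (g x y) * gres hy (csec_fun y))%g
}.

Lemma cocycle_sec_ext (V : opens X) (s t : cocycle_sec V) :
  (forall x, s x = t x) -> s = t.
Proof.
case: s t => [s hs] [t ht] /= st.
have {}st : s = t by exact/functional_extensionality_dep.
by move: hs ht; rewrite st => hs ht; congr CocycleSec; apply: Prop_irrelevance.
Qed.

Lemma csec_resP (V V' : opens X) (h : V' `<=` V) (s : cocycle_sec V) x y (T : opens X)
    (hx : T `<=` opensI V' (U x)) (hy : T `<=` opensI V' (U y))
    (hxy : T `<=` opensI (U x) (U y)) :
  gres hx (gres (opensI_subl (U x) h) (s x)) =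
  (gres hxy (g x y) * gres hy (gres (opensI_subl (U y) h) (s y)))%g.
Proof.
have kx := subset_trans hx (opensI_subl (U x) h).
have ky := subset_trans hy (opensI_subl (U y) h).
by rewrite (gres_comp _ _ kx) (gres_comp _ _ ky); exact: csecP.
Qed.

Definition csec_res (V V' : opens X) (h : V' `<=` V) (s : cocycle_sec V) : cocycle_sec V' :=
  CocycleSec (csec_resP h s).

Lemma csec_res_id (V : opens X) (h : V `<=` V) (s : cocycle_sec V) : csec_res h s = s.
Proof. by apply: cocycle_sec_ext => x /=; rewrite gres_id. Qed.

Lemma csec_res_comp (V V' V'' : opens X) (h : V' `<=` V) (k : V'' `<=` V')
    (l : V'' `<=` V) (s : cocycle_sec V) : csec_res k (csec_res h s) = csec_res l s.
Proof. by apply: cocycle_sec_ext => x /=; exact: gres_comp. Qed.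

Lemma csec_actP (V : opens X) (s : cocycle_sec V) (a : G V) x y (T : opens X)
    (hx : T `<=` opensI V (U x)) (hy : T `<=` opensI V (U y))
    (hxy : T `<=` opensI (U x) (U y)) :
  gres hx (s x * gres (@opensIl _ V (U x)) a)%g =
  (gres hxy (g x y) * gres hy (s y * gres (@opensIl _ V (U y)) a))%g.
Proof.
rewrite !gresM (csecP s hx hy hxy) mulgA.
have k := subset_trans hx (@opensIl _ _ _).
by rewrite !(gres_comp _ _ k).
Qed.

Definition csec_act (V : opens X) (s : cocycle_sec V) (a : G V) : cocycle_sec V :=
  CocycleSec (csec_actP s a).

Lemma csec_act1 (V : opens X) (s : cocycle_sec V) : csec_act s 1%g = s.
Proof. by apply: cocycle_sec_ext => x /=; rewrite gres1 mulg1. Qed.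

Lemma csec_actM (V : opens X) (s : cocycle_sec V) (a b : G V) :
  csec_act s (a * b)%g = csec_act (csec_act s a) b.
Proof. by apply: cocycle_sec_ext => x /=; rewrite gresM mulgA. Qed.

Lemma csec_act_res (V V' : opens X) (k : V' `<=` V) (s : cocycle_sec V) (a : G V) :
  csec_res k (csec_act s a) = csec_act (csec_res k s) (gres k a).
Proof.
apply: cocycle_sec_ext => x /=; rewrite gresM; congr (_ * _)%g.
have l := subset_trans (@opensIl _ V' (U x)) k.
by rewrite !(gres_comp _ _ l).
Qed.

Definition cocycle_space : gspace G :=
  @GSpace X G (@Presheaf X cocycle_sec csec_res csec_res_id csec_res_comp)
    csec_act csec_act1 csec_actM csec_act_res.

Lemma cocycle_space_sheaf : is_sheaf cocycle_space.
Proof.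
move=> V I V' hV cov s compat.
have compatx x i j (T : opens X) (hi : T `<=` opensI (V' i) (U x))
    (hj : T `<=` opensI (V' j) (U x)) : gres hi (s i x) = gres hj (s j x).
  have := congr1 (fun t : cocycle_sec _ => t x) (compat i j); rewrite /=.
  have k : T `<=` opensI (opensI (V' i) (V' j)) (U x).
    by move=> z Tz; have [? ?] := hi z Tz; have [? ?] := hj z Tz.
  move/(congr1 (gres k)).
  by rewrite (gres_comp _ _ hi) (gres_comp _ _ hj).
have hVx x i := opensI_subl (U x) (hV i).
have covx x : opensI V (U x) `<=` \bigcup_i opensI (V' i) (U x).
  by move=> z [/cov[i _ ?] ?]; exists i.
have glue x : exists! t : G (opensI V (U x)), forall i, gres (hVx x i) t = s i x.
  by apply: (shG (hVx x) (covx x)) => i j; exact: compatx.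
pose t x := sval (cid (glue x)).
have tE x i : gres (hVx x i) (t x) = s i x by rewrite /t; case: cid => ? [].
have tP x y (T : opens X) (hx : T `<=` opensI V (U x)) (hy : T `<=` opensI V (U y))
    (hxy : T `<=` opensI (U x) (U y)) :
    gres hx (t x) = (gres hxy (g x y) * gres hy (t y))%g.
  apply: (sheaf_sep shG) => z Tz; have [i _ Viz] := cov z (hx z Tz).1.
  exists (opensI T (V' i)), (@opensIl _ _ _); split=> //=; rewrite gresM.
  have kx : opensI T (V' i) `<=` opensI (V' i) (U x) by move=> w [/hx[]].
  have ky : opensI T (V' i) `<=` opensI (V' i) (U y) by move=> w [/hy[]].
  have kxy : opensI T (V' i) `<=` opensI (U x) (U y) by move=> w [/hxy[]].
  rewrite (gres_comp _ _ (subset_trans kx (hVx x i))) -(gres_comp (hVx x i) kx) tE.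
  rewrite (gres_comp _ _ (subset_trans ky (hVx y i))) -(gres_comp (hVx y i) ky) tE.
  by rewrite (gres_comp _ _ kxy); exact: csecP.
exists (CocycleSec tP); split=> [i|u eu].
  apply: cocycle_sec_ext => x /=; rewrite -(tE x i); exact: gres_irr.
apply: cocycle_sec_ext => x /=; rewrite /t; case: cid => a [_ ua] /=; apply: ua => i.
by rewrite -(eu i) /=; exact: gres_irr.
Qed.

(** The section [e_z] has coordinates [g x z], because [e_z = e_x g_xz]; compatibility of these
    coordinates is the cocycle identity. *)
Lemma cocycle_base_subproof z x y (T : opens X) (hx : T `<=` opensI (U z) (U x))
    (hy : T `<=` opensI (U z) (U y)) (hxy : T `<=` opensI (U x) (U y)) :
  gres hx (gres (opens_inP (@opensIr _ _ _) (@opensIl _ _ _)) (g x z)) =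
  (gres hxy (g x y) *
   gres hy (gres (opens_inP (@opensIr _ _ _) (@opensIl _ _ _)) (g y z)))%g.
Proof.
have kx : T `<=` opensI (U x) (U z) by move=> w /hx[].
have ky : T `<=` opensI (U y) (U z) by move=> w /hy[].
by rewrite (gres_comp _ _ kx) (gres_comp _ _ ky) (g_cocycle _ _ kx).
Qed.

Definition cocycle_base z : cocycle_space (U z) := CocycleSec (@cocycle_base_subproof z).

Lemma cocycle_base_transition : transition cocycle_base g.
Proof.
move=> x y T hx hy hxy; apply: cocycle_sec_ext => z /=.
have kx : opensI T (U z) `<=` opensI (U z) (U x) by move=> w [/hx].
have ky : opensI T (U z) `<=` opensI (U z) (U y) by move=> w [/hy].
have kxy : opensI T (U z) `<=` opensI (U x) (U y) by move=> w [/hxy].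
rewrite !(gres_comp _ _ kxy).
by rewrite (gres_comp _ _ kx) (gres_comp _ _ ky) (g_cocycle _ _ ky).
Qed.

Lemma cocycle_space_torsor : is_torsor cocycle_space.
Proof.
split=> [|x|V s t]; first exact: cocycle_space_sheaf.
  by exists (U x); split; [exact: covP|exact: (inhabits (cocycle_base x))].
have free (V' : opens X) (u : cocycle_space V') a b : gact u a = gact u b -> a = b.
  move=> e; apply: (sheaf_sep shG) => x V'x.
  exists (opensI V' (U x)), (@opensIl _ _ _); split; first by split=> //; exact: covP.
  by have /mulgI := congr1 (fun t : cocycle_sec V' => t x) e.
have [||x Vx|a ea] := @sheaf_local _ _ shG V (fun V' h a => gact (pres h s) a = pres h t).
- by move=> V' h a b <- /free.
- by move=> V' T h k l a e; rewrite -!(pres_comp h k l) -e gact_res.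
(* Near [x], [s = e_x s_x] and [t = e_x t_x], so [s_x^-1 t_x] carries [s] to [t]; in the coordinate
   of any other index [y] the factor [g_yx] cancels. *)
- exists (opensI V (U x)), (@opensIl _ _ _), ((s x)^-1 * t x)%g.
  split; first by split=> //; exact: covP.
  apply: cocycle_sec_ext => y /=; rewrite gresM gresV.
  set T := opensI _ _.
  have kx : T `<=` opensI V (U x) by move=> w [].
  have ky : T `<=` opensI V (U y) by move=> w [[? _] ?].
  have kyx : T `<=` opensI (U y) (U x) by move=> w [[_ ?] ?].
  rewrite !(gres_irr (opensI_subl _ _) ky) !(gres_irr (@opensIl _ _ _) kx).
  by rewrite (csecP s ky kx kyx) (csecP t ky kx kyx) -!mulgA mulVKg.
exists a; split=> [|b eb]; last first.
  apply: (sheaf_sep shG) => x Vx; have [V' [h [V'x e]]] := ea x Vx; exists V', h; split=> //.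
  by apply: free (pres h s) _ _ _; rewrite e -eb gact_res.
apply: (sheaf_sep cocycle_space_sheaf) => x Vx.
by have [V' [h [V'x e]]] := ea x Vx; exists V', h; rewrite -e gact_res.
Qed.

Definition cocycle_torsor : torsor G := Torsor cocycle_space_torsor.

End CocycleTorsor.

(** * Coordinates on [Mc ⊗ A] *)

Section Coordinates.
Variable L : vectType int.

Definition zbasis (i : 'I_(dim L)) : L := r2v (delta_mx 0 i).
Definition zcoord (i : 'I_(dim L)) (m : L) : int := v2r m 0 i.

Lemma zcoordD i : {morph zcoord i : m n / m + n}.
Proof. by move=> m n; rewrite /zcoord raddfD mxE. Qed.

Lemma zcoord_basis i j : zcoord i (zbasis j) = (i == j)%:R.
Proof. by rewrite /zcoord /zbasis r2vK mxE eqxx. Qed.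

Lemma zbasis_sum m : m = \sum_i zbasis i *~ zcoord i m.
Proof.
apply: (can_inj v2rK); rewrite raddf_sum; apply/rowP => j; rewrite summxE.
rewrite (bigD1 j) //= big1 ?addr0 => [|i ij]; rewrite raddfMz /= -scaler_int mxE r2vK mxE.
  by rewrite !eqxx mulr1 intz.
by rewrite eq_sym (negbTE ij) mulr0.
Qed.

End Coordinates.

Lemma morphD_zmod_morphism (A B : zmodType) (f : A -> B) :
  {morph f : x y / x + y} -> zmod_morphism f.
Proof.
move=> fD; have f0 : f 0 = 0 by apply: (addrI (f 0)); rewrite -fD !addr0.
move=> x y; rewrite fD; congr (_ + _).
by apply: (addrI (f y)); rewrite -fD !subrr.
Qed.

Section TensorCoordinates.
Variables (A : zmodType) (L : vectType int).

(* Named partial applications of [tens], to carry its additivity in each variable. *)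
Definition tens_left (a : A) (m : L) : tensor A L := tens a m.
Definition tens_right (m : L) (a : A) : tensor L A := tens m a.
Definition tens_flip_left (m : L) (a : A) : tensor A L := tens a m.
Definition tens_flip_right (a : A) (m : L) : tensor L A := tens m a.

HB.instance Definition _ a := GRing.isZmodMorphism.Build L (tensor A L) (tens_left a)
  (morphD_zmod_morphism (@tensDr _ _ a)).
HB.instance Definition _ m := GRing.isZmodMorphism.Build A (tensor L A) (tens_right m)
  (morphD_zmod_morphism (@tensDr _ _ m)).
HB.instance Definition _ m := GRing.isZmodMorphism.Build A (tensor A L) (tens_flip_left m)
  (morphD_zmod_morphism (fun a a' => tensDl a a' m)).
HB.instance Definition _ a := GRing.isZmodMorphism.Build L (tensor L A) (tens_flip_right a)
  (morphD_zmod_morphism (fun m m' => tensDl m m' a)).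

(** Both orders of the factors occur: [Mc ⊗ H] for transition functions and [Pic ⊗ Mc] for
    classes. *)
Definition tcoordl (i : 'I_(dim L)) : tensor L A -> A :=
  tensor_lift (fun m a => a *~ zcoord i m).
Definition tcoordr (i : 'I_(dim L)) : tensor A L -> A :=
  tensor_lift (fun a m => a *~ zcoord i m).

Lemma tcoordl_zmod_morphism i : zmod_morphism (tcoordl i).
Proof.
by apply: tensor_liftB => [m m' a|m a a']; rewrite ?zcoordD ?mulrzDr ?mulrzDl.
Qed.
Lemma tcoordr_zmod_morphism i : zmod_morphism (tcoordr i).
Proof.
by apply: tensor_liftB => [a a' m|a m m']; rewrite ?zcoordD ?mulrzDr ?mulrzDl.
Qed.
HB.instance Definition _ i := GRing.isZmodMorphism.Build (tensor L A) A (tcoordl i)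
  (tcoordl_zmod_morphism i).
HB.instance Definition _ i := GRing.isZmodMorphism.Build (tensor A L) A (tcoordr i)
  (tcoordr_zmod_morphism i).

Lemma tcoordlE i m a : tcoordl i (tens m a) = a *~ zcoord i m.
Proof.
by apply: tensor_liftE => [{}m m' {}a|{}m {}a a']; rewrite ?zcoordD ?mulrzDr ?mulrzDl.
Qed.
Lemma tcoordrE i a m : tcoordr i (tens a m) = a *~ zcoord i m.
Proof.
by apply: tensor_liftE => [{}a a' {}m|{}a {}m m']; rewrite ?zcoordD ?mulrzDr ?mulrzDl.
Qed.

Lemma tcoordl_sum t : \sum_i tens (zbasis i) (tcoordl i t) = t.
Proof.
elim/tensor_ind: t => [|x y hx hy|m a].
- by apply: big1 => i _; rewrite raddf0; exact: (raddf0 (tens_right _)).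
- rewrite -[in RHS]hx -[in RHS]hy -sumrB; apply: eq_bigr => i _; rewrite raddfB.
  exact: (raddfB (tens_right _)).
rewrite [in RHS](zbasis_sum m) -[RHS]/(tens_flip_right _ _) raddf_sum.
apply: eq_bigr => i _.
by rewrite tcoordlE -[LHS]/(tens_right _ _) !raddfMz.
Qed.

Lemma tcoordr_sum t : \sum_i tens (tcoordr i t) (zbasis i) = t.
Proof.
elim/tensor_ind: t => [|x y hx hy|a m].
- by apply: big1 => i _; rewrite raddf0; exact: (raddf0 (tens_flip_left _)).
- rewrite -[in RHS]hx -[in RHS]hy -sumrB; apply: eq_bigr => i _; rewrite raddfB.
  exact: (raddfB (tens_flip_left _)).
rewrite [in RHS](zbasis_sum m) -[RHS]/(tens_left _ _) raddf_sum.
apply: eq_bigr => i _.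
by rewrite tcoordrE -[LHS]/(tens_flip_left _ _) !raddfMz.
Qed.

Lemma tcoordl_inj t t' : (forall i, tcoordl i t = tcoordl i t') -> t = t'.
Proof.
by move=> e; rewrite -(tcoordl_sum t) -(tcoordl_sum t'); apply: eq_bigr => i _; rewrite e.
Qed.

Lemma tcoordr_inj t t' : (forall i, tcoordr i t = tcoordr i t') -> t = t'.
Proof.
by move=> e; rewrite -(tcoordr_sum t) -(tcoordr_sum t'); apply: eq_bigr => i _; rewrite e.
Qed.

Lemma tcoordl_basis j (a : 'I_(dim L) -> A) :
  tcoordl j (\sum_i tens (zbasis i) (a i)) = a j.
Proof.
rewrite raddf_sum (bigD1 j) //= big1 ?addr0 => [|i ij]; rewrite tcoordlE zcoord_basis.
  by rewrite eqxx.
by rewrite eq_sym (negbTE ij).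
Qed.

Lemma tcoordr_basis j (a : 'I_(dim L) -> A) :
  tcoordr j (\sum_i tens (a i) (zbasis i)) = a j.
Proof.
rewrite raddf_sum (bigD1 j) //= big1 ?addr0 => [|i ij]; rewrite tcoordrE zcoord_basis.
  by rewrite eqxx.
by rewrite eq_sym (negbTE ij).
Qed.

End TensorCoordinates.

Lemma tcoordl_map (A A' : zmodType) (L : vectType int) (f : {additive A -> A'}) i
    (t : tensor L A) : tcoordl i (tensor_map idfun f t) = f (tcoordl i t).
Proof.
elim/tensor_ind: t => [|x y hx hy|m a]; first by rewrite !raddf0.
  by rewrite !raddfB /= hx hy.
by rewrite tensor_mapE !tcoordlE raddfMz.
Qed.

(** * Sheaves of tensors and of harmonic functions *)

Section TensorSheaf.
Variables (X : topologicalType) (F : abpresheaf X) (L : vectType int).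

Definition abpre : presheaf X :=
  @Presheaf X (fun U => F U) (fun U V h => ares F h) (@ares_id X F) (@ares_comp X F).

Definition tensor_res (U V : opens X) (h : V `<=` U) : tensor L (F U) -> tensor L (F V) :=
  tensor_map idfun (ares F h).

Lemma tensor_res_id (U : opens X) (h : U `<=` U) s : tensor_res h s = s.
Proof. by apply: tcoordl_inj => i; rewrite tcoordl_map ares_id. Qed.

Lemma tensor_res_comp (U V W : opens X) (h : V `<=` U) (k : W `<=` V) (l : W `<=` U) s :
  tensor_res k (tensor_res h s) = tensor_res l s.
Proof. by apply: tcoordl_inj => i; rewrite !tcoordl_map (ares_comp _ _ l). Qed.

Definition tensor_presheaf : presheaf X :=
  @Presheaf X (fun U => tensor L (F U)) tensor_res tensor_res_id tensor_res_comp.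

(** The coordinates of a compatible family glue one at a time, and finitely many of them reassemble
    into a single tensor. *)
Lemma tensor_presheaf_sheaf : is_sheaf abpre -> is_sheaf tensor_presheaf.
Proof.
move=> shF U I V hV cov s compat.
have glue k : exists! t : F U, forall i, ares F (hV i) t = tcoordl k (s i).
  apply: (shF U I V hV cov (fun i => tcoordl k (s i))) => i j /=.
  by rewrite -!tcoordl_map; congr tcoordl; exact: compat.
pose t := \sum_k tens (zbasis k) (sval (cid (glue k))).
exists t; split=> [i|u eu]; apply: tcoordl_inj => k.
  by rewrite /= tcoordl_map tcoordl_basis; case: cid => a [ea _] /=; exact: ea.
rewrite tcoordl_basis; case: cid => a [_ ua] /=; apply: ua => i.
by rewrite -(eu i) /= tcoordl_map.
Qed.

End TensorSheaf.

Section HarmonicSheaf.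
Variables (R : realType) (X : metricType R).

Lemma harmonic_at_local (f g : X -> R) (x : X) (V : opens X) : V x ->
  (forall y, V y -> f y = g y) -> harmonic_at f x -> harmonic_at g x.
Proof.
move=> Vx fg hf n r psi st; have [k [k0 [e [/andP[e0 er] he]]]] := hf n r psi st.
have /nbhs_ballP[d /= d0 dV] : nbhs x V by apply: open_nbhs_nbhs; split=> //; exact: oopen.
(* The point [psi i t] is at distance [t] from [x], so [t < d] keeps it inside the ball contained in
   [V]. *)
exists k; split=> //; exists (Num.min e d); rewrite lt_min e0 d0 ge_min er.
split=> // i t /andP[t0]; rewrite lt_min => /andP[te td]; case: (st) => r0 c iso _.
rewrite -!fg // ?he ?t0 //; apply: dV; rewrite ballEmdist /= -(c i).
rewrite iso ?lexx ?r0 ?t0 ?(lt_le_trans te) // eqxx.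
by rewrite sub0r normrN ger0_norm.
Qed.

Lemma harmonic_is_sheaf : is_sheaf (abpre (harmonic_sheaf X)).
Proof.
move=> U I V hV cov s compat.
have agree i j x : V i x -> V j x -> s i x = s j x.
  move=> Vi Vj; have := congr1 (fun f : harmonic_section _ => f x) (compat i j).
  by rewrite /= !patchT // inE.
(* The default value 0 matches the encoding of sections by extension by zero. *)
pose t x := if pselect (exists i, V i x) is left e then s (sval (cid e)) x else 0.
have tE i x : V i x -> t x = s i x.
  rewrite /t => Vx; case: pselect => [e|[]]; last by exists i.
  exact: agree (svalP (cid e)) Vx.
have tP : t \in harmonic_on U.
  apply/asboolP; split=> x Ux.
    by rewrite /t; case: pselect => // e; case: Ux; case: e => i /hV.
  have [i _ Vx] := cov x Ux.
  apply: (harmonic_at_local (f := s i) Vx) => [y Vy|]; first by rewrite -tE.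
  by have /asboolP[_] := harmonicP (s i); exact.
exists (Harmonic tP); split=> [i|u eu].
  by apply: harmonic_ext => x Vx; rewrite /= patchT ?inE //; exact: tE.
apply: harmonic_ext => x Ux; have [i _ Vx] := cov x Ux; rewrite /= (tE i) //.
by rewrite -(eu i) /= patchT // inE.
Qed.

End HarmonicSheaf.

Section SheafUnit.
Variables (X : topologicalType) (G : gpresheaf X).

Lemma gsh_unitM (U : opens X) (s t : G U) : gsh_unit (s * t)%g = (gsh_unit s * gsh_unit t)%g.
Proof. by apply: shsec_ext => x Ux /=; rewrite germ_mulE. Qed.

Lemma gsh_unit1 (U : opens X) : gsh_unit (1%g : G U) = 1%g.
Proof. by apply: shsec_ext => x Ux /=; rewrite -germ_oneE. Qed.

Lemma gsh_unit_res (U V : opens X) (h : V `<=` U) (s : G U) :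
  gres h (gsh_unit s) = gsh_unit (gres h s).
Proof. by apply: shsec_ext => x Vx /=; apply/esym/(@germ_of_res X (gpre G)). Qed.

Lemma gsh_unit_hom (K : gpresheaf X) (f : ghom G K) (U : opens X) (s : G U) :
  gsheafify_hom f U (gsh_unit s) = gsh_unit (f U s).
Proof.
by apply: shsec_ext => x Ux; exact: (@germ_mapE X (gpre G) (gpre K) f (@ghom_res X G K f) x U Ux).
Qed.

Lemma gsh_unit_local (U : opens X) (s : gsheafify G U) x : U x ->
  exists (V : opens X) (h : V `<=` U) (t : G V), V x /\ gres h s = gsh_unit t.
Proof.
move=> Ux; have [V [h [t [Vx e]]]] := sh_loc s Ux.
by exists V, h, t; split=> //; apply: shsec_ext.
Qed.

Lemma gsh_unit_eq (U : opens X) (s t : G U) x : U x -> gsh_unit s = gsh_unit t ->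
  exists (V : opens X) (h : V `<=` U), V x /\ gres h s = gres h t.
Proof.
move=> Ux /(congr1 (fun r : shsec (gpre G) U => r x Ux)) /germ_ofP[V [h [k [Vx e]]]].
by exists V, h; split=> //; rewrite [LHS]e /= (Prop_irrelevance k h).
Qed.

End SheafUnit.

Lemma refine_covers (X : topologicalType) n (T : 'I_n -> pt_cover X) :
  exists S : pt_cover X, forall i x, S x `<=` T i x.
Proof.
elim: n T => [|n IH] T; first by exists (zero_cover X) => -[].
have [S hS] := IH (fun i => T (lift ord0 i)).
exists (coverI (T ord0) S) => i x; case: (unliftP ord0 i) => [j|] ->.
  exact: subset_trans (@opensIr _ _ _) (hS j x).
exact: opensIl.
Qed.

(** * Integer combinations of cocycles on a fixed cover *)

Section CocycleCombination.
Variables (X : topologicalType) (F : abpresheaf X) (U : pt_cover X).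

(** The sum in [cech_H1] is represented on [coverI U U]; a representative on [U] itself is required
    to serve as a transition function there. *)
Lemma cocycle_add (c d : cocycle F U) : exists C : cocycle F U,
  (forall x y, C x y = c x y + d x y) /\ cech_class C = cech_class c + cech_class d.
Proof.
have P x y z (W : opens X) (hxy : W `<=` opensI (U x) (U y))
    (hyz : W `<=` opensI (U y) (U z)) (hxz : W `<=` opensI (U x) (U z)) :
    ares F hxy (c x y + d x y) + ares F hyz (c y z + d y z) = ares F hxz (c x z + d x z).
  by rewrite !aresD /= addrACA (cocycleP c hxy hyz hxz) (cocycleP d hxy hyz hxz).
exists (Cocycle (cocycle_fun := fun x y => c x y + d x y) P); split=> //.
rewrite -[RHS]/(cech_add _ _) cech_addE; apply: cech_class_eq => x y W h k /=.
rewrite /cocycleD_fun !aresD /= (ares_comp _ _ h) (ares_comp _ _ h).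
by congr (_ + _).
Qed.

Lemma cocycle_zero : exists C : cocycle F U,
  (forall x y, C x y = 0) /\ cech_class C = 0.
Proof.
exists (cocycle0 F U); split=> //; apply: cech_class_eq => x y W h k /=.
by rewrite !ares0.
Qed.

Lemma cocycle_mulz (c : cocycle F U) (z : int) : exists C : cocycle F U,
  (forall x y, C x y = c x y *~ z) /\ cech_class C = cech_class c *~ z.
Proof.
have nat n : exists C : cocycle F U,
    (forall x y, C x y = c x y *+ n) /\ cech_class C = cech_class c *+ n.
  elim: n => [|n [C [eC clC]]]; first exact: cocycle_zero.
  have [D [eD clD]] := cocycle_add c C; exists D.
  by rewrite clD clC mulrS; split=> // x y; rewrite eD eC mulrS.
case: z => n; first exact: nat.
have [C [eC clC]] := nat n.+1; exists (cocycleN C); split=> [x y|] /=; first by rewrite eC.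
by rewrite -cech_oppE clC.
Qed.

Lemma cocycle_comb n (c : 'I_n -> cocycle F U) (z : 'I_n -> int) :
  exists C : cocycle F U, (forall x y, C x y = \sum_i c i x y *~ z i) /\
    cech_class C = \sum_i cech_class (c i) *~ z i.
Proof.
elim: n c z => [|n IH] c z.
  have [C [eC clC]] := cocycle_zero; exists C; rewrite big_ord0; split=> // x y.
  by rewrite big_ord0.
have [C [eC clC]] := IH (fun i => c (lift ord0 i)) (fun i => z (lift ord0 i)).
have [D [eD clD]] := cocycle_mulz (c ord0) (z ord0).
have [E [eE clE]] := cocycle_add D C; exists E.
split=> [x y|]; first by rewrite eE eD eC big_ord_recl.
by rewrite clE clD clC big_ord_recl.
Qed.

End CocycleCombination.

(** * The kernel and the splitting of the projection to the constant Weyl sheaf *)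

Section StructureSheaf.
Variables (R : realType) (X : metricType R) (Phi : root_datum).
Notation Mc := (rd_Mc Phi).
Notation H := (harmonic_sheaf X).
Notation GS := (G_sheaf X Phi).
Notation WS := (W_sheaf X Phi).
Notation pi := (G_to_W X Phi).

Lemma G_sheaf_sheaf : is_sheaf (gpre GS). Proof. exact: sheafify_is_sheaf. Qed.
Lemma W_sheaf_sheaf : is_sheaf (gpre WS). Proof. exact: sheafify_is_sheaf. Qed.

Lemma G_inclD (U : opens X) (t t' : tensor Mc (H U)) :
  G_incl (t + t') = (G_incl t * G_incl t')%g.
Proof.
rewrite /G_incl -gsh_unitM; congr gsh_unit; congr (_, _); last by rewrite /= mulg1.
by rewrite /= weyl_actl1.
Qed.

Lemma G_incl_res (U V : opens X) (h : V `<=` U) (t : tensor Mc (H U)) :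
  gres h (G_incl t) = G_incl (tensor_res h t).
Proof. exact: gsh_unit_res. Qed.

Lemma G_incl_W (U : opens X) (t : tensor Mc (H U)) : pi U (G_incl t) = 1%g.
Proof.
by rewrite -[RHS]gsh_unit1; exact: (@gsh_unit_hom X (G_presheaf X Phi)).
Qed.

Lemma Mc_harmonic_sheaf : is_sheaf (tensor_presheaf H Mc).
Proof. exact/tensor_presheaf_sheaf/harmonic_is_sheaf. Qed.

Lemma G_incl_inj (U : opens X) : injective (@G_incl R X Phi U).
Proof.
move=> t t' e; apply: (sheaf_sep Mc_harmonic_sheaf) => x Ux.
have [V [h [Vx /(congr1 fst) eV]]] := gsh_unit_eq Ux e.
by exists V, h.
Qed.

(** Locally [g] is a pair [(t, w)], and its trivial image forces [w = 1]; the tensors [t] are unique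
    by [G_incl_inj], hence glue. *)
Lemma G_inclP (U : opens X) (g : GS U) : pi U g = 1%g -> exists t, g = G_incl t.
Proof.
move=> pg; have [||x Ux|t et] := @sheaf_local _ _ Mc_harmonic_sheaf U
  (fun V h t => gres h g = G_incl t).
- by move=> V h t t' -> /G_incl_inj.
- by move=> V T h k l t e; rewrite -(gres_comp h k l) e G_incl_res.
- have [V [h [[t w] [Vx eV]]]] := gsh_unit_local g Ux.
  have : pi V (gres h g) = 1%g by rewrite ghom_res pg gres1.
  rewrite eV [pi V _](@gsh_unit_hom X (G_presheaf X Phi)) -gsh_unit1.
  case/(gsh_unit_eq Vx) => T [k [Tx ew]].
  exists T, (subset_trans k h), (tensor_res k t); split=> //.
  by rewrite -(gres_comp h k) eV gsh_unit_res /G_incl -(ew : w = 1%g).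
exists t; apply: (sheaf_sep G_sheaf_sheaf) => x Ux; have [V [h [Vx e]]] := et x Ux.
by exists V, h; split=> //; rewrite [LHS]e [RHS]G_incl_res.
Qed.

Definition G_weyl (U : opens X) (w : weyl Phi) : GS U :=
  gsh_unit ((0, w) : G_presheaf X Phi U).

Lemma G_weyl_res (U V : opens X) (h : V `<=` U) w : gres h (G_weyl U w) = G_weyl V w.
Proof.
by rewrite /G_weyl gsh_unit_res; congr gsh_unit; congr (_, _); rewrite /= raddf0.
Qed.

Lemma G_weyl_W (U : opens X) w :
  pi U (G_weyl U w) = gsh_unit (w : const_gpresheaf X (weyl Phi) U).
Proof. exact: (@gsh_unit_hom X (G_presheaf X Phi)). Qed.

(** The commutation rule of the semidirect product, from which the Weyl action on classes arises. *)
Lemma G_weyl_incl (U : opens X) w (t : tensor Mc (H U)) :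
  (G_weyl U w * G_incl t = G_incl (weyl_actl w t) * G_weyl U w)%g.
Proof.
rewrite /G_incl -!gsh_unitM; congr gsh_unit; congr (_, _); rewrite /= ?mulg1 ?mul1g //.
by rewrite weyl_actl0 addr0 add0r.
Qed.

End StructureSheaf.

(** * Transition cocycles of bundles *)

Section Frames.
Variables (R : realType) (X : metricType R) (Phi : root_datum).
Notation Mc := (rd_Mc Phi).
Notation H := (harmonic_sheaf X).
Notation WS := (W_sheaf X Phi).
Notation pi := (G_to_W X Phi).
Notation rk := (dim Mc).
Notation bundle := (G_bundle X Phi).
Notation marking E := (giso (assoc_W E) (trivial_W X Phi)).

Definition transvec (U : pt_cover X) (C : 'I_rk -> cocycle H U) x y :
    tensor Mc (H (opensI (U x) (U y))) :=
  \sum_k tens (zbasis k) (C k x y).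

Definition frame (E : bundle) (U : pt_cover X) (e : forall x, E (U x))
    (C : 'I_rk -> cocycle H U) : Prop :=
  transition e (fun x y => G_incl (transvec C x y)).

Definition Pic_class (U : pt_cover X) (C : 'I_rk -> cocycle H U) : tensor (Pic X) Mc :=
  \sum_k tens (cech_class (C k) : Pic X) (zbasis k).

Lemma Pic_class_inj (U V : pt_cover X) (C : 'I_rk -> cocycle H U)
    (D : 'I_rk -> cocycle H V) :
  Pic_class C = Pic_class D -> forall k, cech_class (C k) = cech_class (D k).
Proof. by move=> e k; have := congr1 (tcoordr k) e; rewrite !tcoordr_basis. Qed.

Lemma transvec_coord (U : pt_cover X) (C : 'I_rk -> cocycle H U) x y
    (T : opens X) (h : T `<=` opensI (U x) (U y)) k :
  tcoordl k (tensor_res h (transvec C x y)) = ares H h (C k x y).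
Proof. by rewrite tcoordl_map tcoordl_basis. Qed.

(** If [f_x = e_x a_x], expressing [f_y] through [e_x] in two ways gives [a_x + D_xy = C_xy + a_y]:
    coordinatewise, [C] and [D] differ by the coboundary of [a]. *)
Lemma frame_class (E : bundle) (U V : pt_cover X) (e : forall x, E (U x))
    (f : forall x, E (V x)) (C : 'I_rk -> cocycle H U) (D : 'I_rk -> cocycle H V) :
  frame e C -> frame f D ->
  (forall x, exists a, pres (@opensIr X (U x) (V x)) (f x) =
    gact (pres (@opensIl X (U x) (V x)) (e x)) (G_incl a)) ->
  Pic_class C = Pic_class D.
Proof.
move=> fe ff ex; apply: eq_bigr => k _; congr tens.
pose a x := sval (cid (ex x)).
have aE x : pres (@opensIr X (U x) (V x)) (f x) =
    gact (pres (@opensIl X (U x) (V x)) (e x)) (G_incl (a x)) by exact: svalP (cid (ex x)).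
apply/cech_classP; exists (coverI U V), (fun x => tcoordl k (a x)); split=> [x|].
  by rewrite /=; split; [exact: opensIl|exact: opensIr].
move=> x y T; rewrite [cech_cover _]/= [cech_cover _]/= => hx hy ha hb.
have Ux := subset_trans hx (@opensIl _ _ _); have Uy := subset_trans hy (@opensIl _ _ _).
have Vx := subset_trans hx (@opensIr _ _ _); have Vy := subset_trans hy (@opensIr _ _ _).
have aT z (h : T `<=` coverI U V z) (hU : T `<=` U z) (hV : T `<=` V z) :
    pres hV (f z) = gact (pres hU (e z)) (G_incl (tensor_res h (a z))).
  by rewrite -(pres_comp (@opensIr X (U z) (V z)) h hV) aE gact_res (pres_comp _ _ hU) G_incl_res.
have : G_incl (tensor_res hx (a x) + tensor_res hb (transvec D x y)) =
       G_incl (tensor_res ha (transvec C x y) + tensor_res hy (a y)).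
  apply: (torsor_free (s := pres Ux (e x))); rewrite !G_inclD !gactM.
  rewrite -(aT x hx Ux Vx) -!G_incl_res -(ff x y T Vx Vy hb) -(fe x y T Ux Uy ha).
  by rewrite G_incl_res -(aT y hy Uy Vy).
move=> /G_incl_inj /(congr1 (tcoordl k)).
rewrite !raddfD /= !transvec_coord !tcoordl_map /= => eT.
by rewrite addrA -eT addrC addrA addNr add0r.
Qed.

(** A cochain relating [C] to [D] corrects the sections [f_x] until their transition functions
    become [C]. The correction [a] is part of the conclusion because, lying in the kernel, it shows
    that the map respects markings. *)
Lemma frame_iso (E F : bundle) (U V : pt_cover X) (e : forall x, E (U x))
    (f : forall x, F (V x)) (C : 'I_rk -> cocycle H U) (D : 'I_rk -> cocycle H V) :
  frame e C -> frame f D -> Pic_class C = Pic_class D ->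
  exists (h : gmap E F) (T : pt_cover X) (hU : forall x, T x `<=` U x)
    (hV : forall x, T x `<=` V x) (a : forall x, tensor Mc (H (T x))),
    forall x, h (T x) (pres (hU x) (e x)) = gact (pres (hV x) (f x)) (G_incl (a x)).
Proof.
move=> fe ff /Pic_class_inj eC.
have coh k : exists Tp : {T : pt_cover X & forall x, H (T x)},
    (forall x, projT1 Tp x `<=` U x /\ projT1 Tp x `<=` V x) /\
    forall x y (T : opens X) (hx : T `<=` projT1 Tp x) (hy : T `<=` projT1 Tp y)
      (ha : T `<=` opensI (U x) (U y)) (hb : T `<=` opensI (V x) (V y)),
      ares H hb (D k x y) =
      ares H ha (C k x y) + (ares H hy (projT2 Tp y) - ares H hx (projT2 Tp x)).
  by have [T [p hT]] := (cech_classP _ _).1 (eC k); exists (existT _ T p).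
pose Tp k := sval (cid (coh k)); have TpP k := svalP (cid (coh k)).
have [S0 hS0] := refine_covers (fun k => projT1 (Tp k)).
pose S := coverI S0 (coverI U V).
have hU x : S x `<=` U x by move=> z [_ []].
have hV x : S x `<=` V x by move=> z [_ []].
have hS k x : S x `<=` projT1 (Tp k) x by exact: subset_trans (@opensIl _ _ _) (hS0 k x).
(* The sign: from [D = C + p_y - p_x], the transition function of [f_x a_x] is [D + a_y - a_x],
   which equals [C] for [a = -p]. *)
pose a x := - \sum_k tens (zbasis k) (ares H (hS k x) (projT2 (Tp k) x)).
pose g x y := gres (opens_inP (subset_trans (@opensIl _ _ _) (hU x))
   (subset_trans (@opensIr _ (S x) (S y)) (hU y))) (G_incl (transvec C x y)).
have [||h hE] := @glue_map _ _ E F S (fun x => pres (hU x) (e x))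
    (fun x => gact (pres (hV x) (f x)) (G_incl (a x))) g.
- move=> x y T hx hy hxy; have ha := opens_inP (subset_trans hx (hU x)) (subset_trans hy (hU y)).
  rewrite (pres_comp _ _ (subset_trans hx (hU x))) (pres_comp _ _ (subset_trans hy (hU y))).
  by rewrite (gres_comp _ _ ha); exact: fe.
- move=> x y T hx hy hxy.
  have ha := opens_inP (subset_trans hx (hU x)) (subset_trans hy (hU y)).
  have hb := opens_inP (subset_trans hx (hV x)) (subset_trans hy (hV y)).
  rewrite (gres_comp _ _ ha) !gact_res !(pres_comp _ _ (subset_trans hx (hV x))).
  rewrite (pres_comp _ _ (subset_trans hy (hV y))) (ff x y T (subset_trans hx (hV x)) _ hb) -!gactM.
  rewrite !G_incl_res -!G_inclD; congr (gact _ (G_incl _)); apply: tcoordl_inj => k.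
  have aC z : tcoordl k (a z) = - ares H (hS k z) (projT2 (Tp k) z).
    by rewrite raddfN; congr (- _); exact: tcoordl_basis.
  rewrite !raddfD /= !transvec_coord !tcoordl_map !aC !aresN.
  have kx := subset_trans hx (hS k x); have ky := subset_trans hy (hS k y).
  rewrite (ares_comp _ _ kx) (ares_comp _ _ ky) ((TpP k).2 x y T kx ky ha hb).
  by rewrite [RHS]addrC -addrA; congr (_ + _); rewrite addrAC subrr add0r.
by exists h, S, hU, hV, a.
Qed.

(** Expanding each [m i] in the basis gives [C_k] as the combination of the [c i] with coefficients
    [zcoord k (m i)]; the same expansion computes the class in [Pic ⊗ Mc]. *)
Lemma frame_of_transition (E : bundle) (U : pt_cover X) (e : forall x, E (U x)) n
    (c : 'I_n -> cocycle H U) (m : 'I_n -> Mc) :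
  transition e (fun x y => G_incl (\sum_i tens (m i) (c i x y))) ->
  exists2 C, frame e C & Pic_class C = \sum_i tens (cech_class (c i) : Pic X) (m i).
Proof.
move=> te; have comb k := cid (cocycle_comb c (fun i => zcoord k (m i))).
exists (fun k => sval (comb k)).
  move=> x y T hx hy hxy; rewrite (te x y T hx hy hxy); congr gact; congr gres.
  congr G_incl; apply: tcoordl_inj => k; rewrite tcoordl_basis (svalP (comb k)).1 raddf_sum.
  by apply: eq_bigr => i _; rewrite /= tcoordlE.
apply: tcoordr_inj => k; rewrite tcoordr_basis (svalP (comb k)).2 raddf_sum.
by apply: eq_bigr => i _; rewrite /= tcoordrE.
Qed.

Definition normal (E : bundle) (phi : marking E) (U : pt_cover X)
    (e : forall x, E (U x)) : Prop :=
  forall x, phi (U x) (push_section pi (e x)) = 1%g :> WS (U x).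

Lemma marking_act (E : bundle) (phi : marking E) (V : opens X) (s : E V) g :
  phi V (push_section pi (gact s g)) = (phi V (push_section pi s) * pi V g : WS V)%g.
Proof. by rewrite push_section_act gmap_act. Qed.

Lemma marking_res (E : bundle) (phi : marking E) (U V : opens X) (h : V `<=` U) (s : E U) :
  phi V (push_section pi (pres h s)) = gres h (phi U (push_section pi s) : WS U).
Proof. by rewrite push_section_res gmap_res. Qed.

Lemma normal_diff (E : bundle) (phi : marking E) (V : opens X) (s t : E V) :
  phi V (push_section pi s) = (1%g : WS V) -> phi V (push_section pi t) = (1%g : WS V) ->
  exists a, t = gact s (G_incl a).
Proof.
have [g <-] := torsor_trans s t; rewrite marking_act => -> pg.
have /G_inclP[a ->] : pi V g = 1%g by rewrite -[LHS]mul1g.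
by exists a.
Qed.

Lemma normal_frame_exists (E : bundle) (phi : marking E) :
  exists (U : pt_cover X) (e : forall x, E (U x)) C, normal phi e /\ frame e C.
Proof.
have loc x : exists Te : {T : opens X & E T},
    projT1 Te x /\ phi _ (push_section pi (projT2 Te)) = 1%g :> WS (projT1 Te).
  have [V [s Vx]] := torsor_section E x.
  have [T [h [w [Tx ew]]]] := gsh_unit_local (phi V (push_section pi s) : WS V) Vx.
  (* The marking takes the constant value [w] on [s] over [T]; translating by the lift of [w^-1]
     normalizes it to 1. *)
  exists (existT _ T (gact (pres h s) (G_weyl T w^-1%g))); split=> //=.
  rewrite marking_act marking_res ew G_weyl_W -gsh_unitM -[RHS]gsh_unit1.
  by congr gsh_unit; exact: mulgV.
pose Te x := sval (cid (loc x)); have TeP x := svalP (cid (loc x)).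
pose U := Cover (cov := fun x => projT1 (Te x)) (fun x => (TeP x).1).
pose e x : E (U x) := projT2 (Te x).
have ne : normal phi e by move=> x; exact: (TeP x).2.
have ext x y : exists t, pres (@opensIr X (U x) (U y)) (e y) =
    gact (pres (@opensIl X (U x) (U y)) (e x)) (G_incl t).
  by apply: (@normal_diff E phi); rewrite marking_res ne gres1.
pose t x y := sval (cid (ext x y)).
have te : transition e (fun x y => G_incl (t x y)).
  by apply/transitionP => x y; exact: svalP (cid (ext x y)).
have tP k x y z (W : opens X) (hxy : W `<=` opensI (U x) (U y))
    (hyz : W `<=` opensI (U y) (U z)) (hxz : W `<=` opensI (U x) (U z)) :
    ares H hxy (tcoordl k (t x y)) + ares H hyz (tcoordl k (t y z)) =
    ares H hxz (tcoordl k (t x z)).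
  (* The cocycle identity holds because both sides carry [e x] to [e z] and the action is free. *)
  rewrite -!tcoordl_map -raddfD; congr tcoordl; apply: (@G_incl_inj R X Phi).
  have hx := subset_trans hxy (@opensIl _ _ _); have hy := subset_trans hxy (@opensIr _ _ _).
  have hz := subset_trans hyz (@opensIr _ _ _).
  apply: (torsor_free (s := pres hx (e x))); rewrite G_inclD gactM -!G_incl_res.
  by rewrite -(te x y W hx hy) -(te y z W hy hz) -(te x z W hx hz).
exists U, e, (fun k => Cocycle (tP k)); split=> // x y T hx hy hxy.
rewrite (te x y T hx hy hxy); congr gact; congr gres; congr G_incl.
by rewrite -[LHS]tcoordl_sum.
Qed.

Lemma normal_frame_class (E : bundle) (phi : marking E) (U V : pt_cover X)
    (e : forall x, E (U x)) (f : forall x, E (V x))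
    (C : 'I_rk -> cocycle H U) (D : 'I_rk -> cocycle H V) :
  normal phi e -> frame e C -> normal phi f -> frame f D -> Pic_class C = Pic_class D.
Proof.
move=> ne fe nf ff; apply: frame_class fe ff _ => x.
by apply: (@normal_diff E phi); rewrite marking_res (ne, nf) gres1.
Qed.

(** Representatives of the coordinates of [t], restricted to a common cover, form a cocycle in the
    kernel; the glued torsor then carries a marking by [marking_exists]. *)
Lemma marked_bundle_exists (t : tensor (Pic X) Mc) :
  exists (E : bundle) (phi : marking E) (U : pt_cover X) (e : forall x, E (U x)) C,
    [/\ normal phi e, frame e C & Pic_class C = t].
Proof.
have rep k : exists Uc : {U : pt_cover X & cocycle H U},
    tcoordr k t = cech_class (projT2 Uc).
  by have [U [c ec]] := cech_elim (tcoordr k t); exists (existT _ U c).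
pose Uc k := sval (cid (rep k)).
have UcP k : tcoordr k t = cech_class (projT2 (Uc k)) by exact: svalP (cid (rep k)).
have [U hU] := refine_covers (fun k => projT1 (Uc k)).
have hUU k x y : opensI (U x) (U y) `<=` opensI (projT1 (Uc k) x) (projT1 (Uc k) y).
  by move=> z [/hU + /hU].
have CP k x y z (W : opens X) (hxy : W `<=` opensI (U x) (U y))
    (hyz : W `<=` opensI (U y) (U z)) (hxz : W `<=` opensI (U x) (U z)) :
    ares H hxy (ares H (hUU k x y) (projT2 (Uc k) x y)) +
    ares H hyz (ares H (hUU k y z) (projT2 (Uc k) y z)) =
    ares H hxz (ares H (hUU k x z) (projT2 (Uc k) x z)).
  rewrite (ares_comp _ _ (subset_trans hxy (hUU k x y))).
  rewrite (ares_comp _ _ (subset_trans hyz (hUU k y z))).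
  by rewrite (ares_comp _ _ (subset_trans hxz (hUU k x z))); exact: cocycleP.
pose C k := Cocycle (CP k).
have gP x y z (T : opens X) (hxy : T `<=` opensI (U x) (U y))
    (hyz : T `<=` opensI (U y) (U z)) (hxz : T `<=` opensI (U x) (U z)) :
    (gres hxy (G_incl (transvec C x y)) * gres hyz (G_incl (transvec C y z)) =
     gres hxz (G_incl (transvec C x z)))%g.
  rewrite !G_incl_res -G_inclD; congr G_incl; apply: tcoordl_inj => k.
  by rewrite raddfD [LHS]/= !transvec_coord; exact: (cocycleP (C k) hxy hyz hxz).
pose E : bundle := cocycle_torsor (@G_sheaf_sheaf R X Phi) gP.
have te := cocycle_base_transition gP.
have [|phi ephi] := @marking_exists X _ (const_gpresheaf X (weyl Phi)) pi E U _ _ te.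
  by move=> x y; exact: G_incl_W.
exists E, phi, U, (cocycle_base gP), C; split=> //.
apply: tcoordr_inj => k; rewrite tcoordr_basis UcP.
apply: cech_class_eq => x y W h h'.
exact: (ares_comp (hUU k x y) h h').
Qed.

End Frames.

(** * Isomorphism classes *)

Section GspaceMaps.
Variables (X : topologicalType) (G K : gpresheaf X) (pi : ghom G K).

Definition gmap_id (P : gspace G) : gmap P P :=
  @GMap X G P P (fun U s => s) (fun U V k s => erefl) (fun U s g => erefl).

Lemma gmap_comp_res (P Q S : gspace G) (f : gmap Q S) (h : gmap P Q) (U V : opens X)
    (k : V `<=` U) (s : P U) : f V (h V (pres k s)) = pres k (f U (h U s)).
Proof. by rewrite !gmap_res. Qed.

Lemma gmap_comp_act (P Q S : gspace G) (f : gmap Q S) (h : gmap P Q) (U : opens X)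
    (s : P U) (g : G U) : f U (h U (gact s g)) = gact (f U (h U s)) g.
Proof. by rewrite !gmap_act. Qed.

Definition gmap_comp (P Q S : gspace G) (f : gmap Q S) (h : gmap P Q) : gmap P S :=
  GMap (gmap_comp_res f h) (gmap_comp_act f h).

Lemma push_map_section (P Q : gspace G) (f : gmap P Q) (U : opens X) (s : P U) :
  push_map pi f U (push_section pi s) = push_section pi (f U s).
Proof.
apply: shsec_ext => x Ux /=; rewrite (germ_mapE (push_quot_map_res (pi := pi) f)).
by rewrite push_quot_mapE.
Qed.

End GspaceMaps.

Lemma iso_class_eq (T : Type) (r : T -> T -> Prop) (x y : T) :
  (forall z, r x z <-> r y z) -> iso_class r x = iso_class r y.
Proof.
move=> e; have exy : r x = r y by apply/funext => z; apply/propext.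
by apply: eq_sig_hprop => // C p q; exact: Prop_irrelevance.
Qed.

(** Being the kernel of [f], the relation [r] is an equivalence whose classes are the fibres of
    [f]. *)
Lemma iso_classes_bij (T : Type) (r : T -> T -> Prop) (S : Type) (f : T -> S) :
  (forall x y, r x y <-> f x = f y) -> (forall s, exists x, f x = s) ->
  exists2 b : iso_classes r -> S, bijective b & forall x, b (iso_class r x) = f x.
Proof.
move=> rf surj; have rep (c : iso_classes r) : exists x, c = iso_class r x.
  case: c => C [x eC]; exists x.
  by apply: eq_sig_hprop => // C' p q; exact: Prop_irrelevance.
pose b c := f (sval (cid (rep c))).
have bE x : b (iso_class r x) = f x.
  rewrite /b; case: cid => y /= /(congr1 sval) /= e; apply/rf.
  by rewrite -e; apply/rf.
exists b => //; exists (fun s => iso_class r (sval (cid (surj s)))) => [c|s].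
  have [x ->] := rep c; rewrite bE; case: cid => y /= fy.
  by apply: iso_class_eq => z; split=> /rf e; apply/rf; congruence.
by rewrite bE; case: cid.
Qed.

Lemma locally_constant_section (X : topologicalType) (W : groupType) :
  connected [set: X] -> forall s : gsheafify (const_gpresheaf X W) (Opens openT),
  exists w : W, s = gsh_unit (w : const_gpresheaf X W (Opens openT)).
Proof.
(* [connected] admits the empty space, over which any [w] will do. *)
move=> conn s; case: (pselect (exists x : X, True)) => [[x0 _]|nX]; last first.
  by exists 1%g; apply: shsec_ext => x; case: nX; exists x.
pose WG := const_gpresheaf X W.
pose u (w : W) : gsheafify WG (Opens openT) := gsh_unit (w : WG (Opens openT)).
have loc x (w : W) : s x I = u w x I -> exists2 V : opens X, V x & forall y, V y -> s y I = u w y I.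
  have [V [h [w' [Vx e]]]] := gsh_unit_local s (I : Opens openT x).
  have sE y (Vy : V y) : s y I = u w' y I.
    have := congr1 (fun t : shsec (gpre WG) V => t y Vy) e.
    rewrite /= (shsec_irr s _ I) => ->.
    exact: (@germ_of_res X (gpre WG) y (Opens openT) V h I Vy w').
  move=> ew; exists V => // y Vy; rewrite sE //.
  suff -> : w = w' by [].
  by move: ew; rewrite sE // => /germ_ofP[T [? [? [_ ?]]]].
have ex x : exists w, s x I = u w x I.
  have [V [h [w [Vx e]]]] := gsh_unit_local s (I : Opens openT x); exists w.
  have := congr1 (fun t : shsec (gpre WG) V => t x Vx) e.
  rewrite /= (shsec_irr s _ I) => ->.
  exact: (@germ_of_res X (gpre WG) x (Opens openT) V h I Vx w).
have [w0 e0] := ex x0; exists w0.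
(* The locus where [s] agrees with the constant [w0] is open and closed, since [s] is locally
   constant and distinct constants have distinct germs everywhere. *)
pose B := [set x | s x I = u w0 x I].
have oB : open B.
  rewrite openE => x /loc[V Vx hV].
  by apply: filterS (open_nbhs_nbhs (conj (oopen V) Vx)) => y /hV.
have cB : closed B.
  rewrite -openC openE => x nBx; have [w ew] := ex x; have [V Vx hV] := loc x w ew.
  apply: filterS (open_nbhs_nbhs (conj (oopen V) Vx)) => y Vy By; apply: nBx.
  rewrite /B /= ew; suff -> : w = w0 by [].
  by move: By; rewrite /B /= hV // => /germ_ofP[T [? [? [_ ?]]]].
have BT : B = setT.
  apply: conn; first by exists x0.
    by exists B => //; rewrite setTI.
  by exists B => //; rewrite setTI.
apply: shsec_ext => x Ux; rewrite (shsec_irr s _ I).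
have : B x by rewrite BT.
by move=> ->; rewrite (shsec_irr (u w0) _ Ux).
Qed.

(** * Classes of marked bundles and Weyl orbits *)

Section Classification.
Variables (R : realType) (X : metricType R) (Phi : root_datum).
Notation Mc := (rd_Mc Phi).
Notation H := (harmonic_sheaf X).
Notation WS := (W_sheaf X Phi).
Notation pi := (G_to_W X Phi).
Notation rk := (dim Mc).
Notation bundle := (G_bundle X Phi).
Notation marked := (marked_bundle (trivial_W X Phi)).

Definition bundle_Pic_class (E : marked) : tensor (Pic X) Mc :=
  let: exist U h := cid (normal_frame_exists (mb_iso E)) in
  let: exist e h := cid h in let: exist C _ := cid h in Pic_class C.

Lemma bundle_Pic_classE (E : marked) (U : pt_cover X) (e : forall x, mb_bundle E (U x))
    (C : 'I_rk -> cocycle H U) :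
  normal (mb_iso E) e -> frame e C -> bundle_Pic_class E = Pic_class C.
Proof.
move=> ne fe; rewrite /bundle_Pic_class; case: cid => V h; case: cid => f h'.
case: cid => D [nf ff]; exact: normal_frame_class nf ff ne fe.
Qed.

(** An isomorphism carries a normal frame to a normal frame with the same cocycles. Conversely, the
    map of [frame_iso] sends [e_x] to [f_x] times a kernel section, so the two markings agree on
    these sections and hence everywhere. *)
Lemma marked_isoP (E F : marked) :
  marked_iso E F <-> bundle_Pic_class E = bundle_Pic_class F.
Proof.
have [U [e [C [ne fe]]]] := normal_frame_exists (mb_iso E).
split=> [[h hE]|]; rewrite (bundle_Pic_classE ne fe).
  apply/esym/(@bundle_Pic_classE F U (fun x => h _ (e x))).
    by move=> x; rewrite -push_map_section hE.
  by move=> x y T hx hy hxy; rewrite -!gmap_res -gmap_act -fe.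
have [V [f [D [nf ff]]]] := normal_frame_exists (mb_iso F).
rewrite (bundle_Pic_classE nf ff) => /(frame_iso fe ff)[h [T [hU [hV [a ha]]]]].
exists (torsor_iso h) => W s; set phiF := mb_iso F.
apply: (@gmap_eq _ _ (push_torsor pi (@W_sheaf_sheaf R X Phi) (mb_bundle E)) _
  (gmap_comp phiF (push_map pi h)) (mb_iso E)).
  exact: torsor_sheaf.
move=> x; exists (T x), (push_section pi (pres (hU x) (e x))); split; first exact: covP.
rewrite -[LHS]/(phiF _ (push_map pi h _ (push_section pi (pres (hU x) (e x))))).
rewrite push_map_section ha marking_act !marking_res nf ne G_incl_W !gres1.
exact: mulg1.
Qed.

Lemma weyl_actr_Pic_class w (U : pt_cover X) (C : 'I_rk -> cocycle H U) :
  weyl_actr w (Pic_class C) =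
  \sum_k tens (cech_class (C k) : Pic X) (w (zbasis k)).
Proof.
rewrite /weyl_actr raddf_sum; apply: eq_bigr => k _; exact: tensor_mapE.
Qed.

(** Conjugation turns [b_k ⊗ C_k] into [w b_k ⊗ C_k]. As the [w b_k] are no longer the chosen basis
    vectors, [frame_of_transition] re-expands them. *)
Lemma frame_twist (E : bundle) (U : pt_cover X) (e : forall x, E (U x))
    (C : 'I_rk -> cocycle H U) w : frame e C ->
  exists2 D, frame (fun x => gact (e x) (G_weyl (U x) w^-1%g)) D &
    Pic_class D = weyl_actr w (Pic_class C).
Proof.
move=> fe; rewrite weyl_actr_Pic_class.
apply: (@frame_of_transition _ _ _ E U _ _ C (fun k => w (zbasis k))).
move=> x y T hx hy hxy; rewrite !gact_res (fe x y T hx hy hxy) -!gactM !G_weyl_res.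
congr gact; have -> : \sum_k tens (w (zbasis k)) (C k x y) = weyl_actl w (transvec C x y).
  by rewrite /weyl_actl raddf_sum; apply: eq_bigr => k _; rewrite /= tensor_mapE.
have GV V : (G_weyl V w^-1 * G_weyl V w = 1 :> G_sheaf X Phi V)%g.
  rewrite /G_weyl -gsh_unitM -gsh_unit1; congr gsh_unit; congr (_, _).
    by rewrite /= weyl_actl0 addr0.
  exact: mulVg.
have -> : G_incl (weyl_actl w (transvec C x y)) =
    (G_weyl _ w * G_incl (transvec C x y) * G_weyl _ w^-1)%g.
  have GV' : (G_weyl _ w * G_weyl _ w^-1 = 1 :> G_sheaf X Phi _)%g.
    by move=> V; apply: (mulgI (G_weyl V w^-1%g)); rewrite mulgA GV mul1g mulg1.
  by rewrite G_weyl_incl -mulgA GV' mulg1.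
by rewrite !gresM !G_weyl_res !mulgA GV mul1g.
Qed.

Hypothesis X_connected : connected [set: X].

Lemma bundle_iso_orbit (E F : marked) (h : gmap (mb_bundle E) (mb_bundle F)) :
  exists w, bundle_Pic_class F = weyl_actr w (bundle_Pic_class E).
Proof.
have [U [e [C [ne fe]]]] := normal_frame_exists (mb_iso E).
have fhe : frame (fun x => h _ (e x)) C.
  by move=> x y T hx hy hxy; rewrite -!gmap_res -gmap_act -fe.
(* Transported by [h], the normal frame of [E] has values [om x] under the marking of [F]. They
   agree on overlaps, so they measure the discrepancy of the two markings by a global section of
   [W_Gam], constant by connectedness. *)
pose om x : WS (U x) := mb_iso F _ (push_section pi (h _ (e x))).
have om_agree x y (T : opens X) (hx : T `<=` U x) (hy : T `<=` U y) :
    gres hy (om y) = gres hx (om x).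
  rewrite /om -!marking_res (fhe x y T hx hy (opens_inP hx hy)) marking_act.
  by rewrite G_incl_res G_incl_W mulg1.
have [||s [sE _]] := @W_sheaf_sheaf R X Phi (Opens openT) X U (fun x => @subsetT _ _) _ om.
- by move=> x _; exists x => //; exact: covP.
- by move=> x y; apply/esym/om_agree.
have [w ew] := locally_constant_section X_connected s.
exists w; rewrite (bundle_Pic_classE ne fe).
have [D fD <-] := frame_twist w fhe.
apply: bundle_Pic_classE fD => x; rewrite marking_act -/(om x) -(sE x) ew G_weyl_W.
rewrite [pres _ _]gsh_unit_res -gsh_unitM -[RHS]gsh_unit1; congr gsh_unit; exact: mulgV.
Qed.

Lemma orbit_bundle_iso (E F : marked) w :
  bundle_Pic_class F = weyl_actr w (bundle_Pic_class E) ->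
  inhabited (giso (mb_bundle E) (mb_bundle F)).
Proof.
have [U [e [C [ne fe]]]] := normal_frame_exists (mb_iso E).
have [V [f [D [nf ff]]]] := normal_frame_exists (mb_iso F).
rewrite (bundle_Pic_classE ne fe) (bundle_Pic_classE nf ff).
have [C' fC' <-] := frame_twist w fe.
by move=> /esym /(frame_iso fC' ff)[h _]; exact: (inhabits (torsor_iso h)).
Qed.

Lemma W_orbit_eq (t t' : tensor (Pic X) Mc) :
  W_orbit t = W_orbit t' <-> exists w : weyl Phi, t' = weyl_actr w t.
Proof.
have actM v w t0 : weyl_actr (v * w)%g t0 = weyl_actr v (weyl_actr w t0).
  by apply/esym/tensor_map_comp.
have act1 t0 : weyl_actr (1%g : weyl Phi) t0 = t0.
  rewrite -[RHS]tensor_map_id; elim/tensor_ind: t0 => [|x y hx hy|a m].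
  - by rewrite /weyl_actr !raddf0.
  - by move: hx hy; rewrite /weyl_actr !raddfB /= => -> ->.
  by rewrite /weyl_actr !tensor_mapE.
split=> [/(congr1 sval) /= e|[w ->]].
  by have [w ew] : W_orbit_rel t t' by [rewrite e; exists 1%g; rewrite act1]; exists w.
apply: iso_class_eq => t0; split=> [[v ->]|[v ->]].
  by exists (v * w^-1)%g; rewrite -actM -mulgA mulVg mulg1.
by exists (v * w)%g; rewrite actM.
Qed.

End Classification.

Theorem proposition4p10 (R : realType) (Gam : metricType R)
    (Gam_graph : metric_graph Gam) (Gam_compact : compact [set: Gam])
    (Gam_connected : connected [set: Gam]) (Phi : root_datum) :
  exists (beta : Mtilde (trivial_W Gam Phi) -> tensor (Pic Gam) (rd_Mc Phi))
         (gamma : Mbundle (trivial_W Gam Phi) -> W_orbits Gam Phi),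
  [/\ bijective beta,
      bijective gamma,
      forall (E : marked_bundle (trivial_W Gam Phi)) (U : pt_cover Gam) (n : nat)
          (c : 'I_n -> cocycle (harmonic_sheaf Gam) U) (m : 'I_n -> rd_Mc Phi),
        has_transition E c m ->
        beta (marked_class E) = \sum_(i < n) tens (cech_class (c i)) (m i)
    & forall E : marked_bundle (trivial_W Gam Phi),
        gamma (bundle_class (mb_iso E)) = W_orbit (beta (marked_class E))].
Proof.
pose marked := marked_bundle (trivial_W Gam Phi).
have orbitP (E F : marked) : inhabited (giso (mb_bundle E) (mb_bundle F)) <->
    W_orbit (bundle_Pic_class E) = W_orbit (bundle_Pic_class F).
  split=> [[h]|/W_orbit_eq[w]]; last exact: orbit_bundle_iso.
  exact/W_orbit_eq/(bundle_iso_orbit Gam_connected h).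
have surj t : exists E : marked, bundle_Pic_class E = t.
  have [E [phi [U [e [C [ne fe <-]]]]]] := marked_bundle_exists t.
  by exists (MarkedBundle phi); exact: (@bundle_Pic_classE _ _ _ (MarkedBundle phi) U e C ne fe).
have [beta beta_bij betaE] := iso_classes_bij (@marked_isoP R Gam Phi) surj.
(* A point of [Mbundle] records only that a marking exists, so one is chosen; by [orbitP] the orbit
   is independent of the choice. *)
have markE (E : bundle_of_type (trivial_W Gam Phi)) :
    exists phi : giso (assoc_W (sval E)) (trivial_W Gam Phi), True.
  by case: E => E [phi]; exists phi.
pose mark E : marked := MarkedBundle (sval (cid (markE E))).
have [||gamma gamma_bij gammaE] := @iso_classes_bij _ (@bundle_iso R Gam Phi _) _
    (fun E => W_orbit (bundle_Pic_class (mark E))).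
- by move=> E F; exact: (orbitP (mark E) (mark F)).
- move=> [O [t eO]]; have [E Et] := surj t.
  exists (exist _ (mb_bundle E) (inhabits (mb_iso E))).
  have -> : exist _ O (ex_intro _ t eO) = W_orbit t.
    by apply: eq_sig_hprop => // ? ? ?; exact: Prop_irrelevance.
  (* The chosen marking may differ from that of [E]; the identity of the underlying bundle shows
     that the orbits coincide. *)
  rewrite -Et; apply/orbitP; exact: (inhabits (torsor_iso (gmap_id _))).
exists beta, gamma; split=> // [E U n c m [e [ne te]]|E]; last first.
  rewrite gammaE betaE; apply/orbitP; exact: (inhabits (torsor_iso (gmap_id _))).
have [C fC <-] := frame_of_transition ((transitionP _ _).1 te).
by rewrite betaE (bundle_Pic_classE ne fC).
Qed.
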